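(* Consider the general case in which the log-likelihood ratio $\ell$ is unbounded, and assume that $\ell(X)$ is $\sigma^2$-sub-Gaussian under both the pre- and post-change distributions, i.e. for $i=0,1$ and all $\lambda\in\mathbb R$, $$\mathbf E_{X\sim f_i}\big[e^{\lambda(\ell(X)-\mathbf E_{X\sim f_i}[\ell(X)])}\big]\le e^{\lambda^2\sigma^2/2}.$$ Then for any $\epsilon>0$, $\delta\in(0,1)$, $b>0$, and the corresponding $A_\delta$, the $\delta$-DP-CUSUM stopping time $\tilde T(b)$ (Laplace noise scale $2A_\delta/\epsilon$) satisfies $$\mathrm{WADD}(\tilde T(b))\le\frac{b}{I_0}+\frac{4A_\delta}{I_0^{3/2}\epsilon}\sqrt b+C,$$ where $I_0=\mathbf E_{X\sim f_1}[\ell(X)]$ and $C$ is a constant that does not depend on the threshold $b$ but depends on $\epsilon,\delta,I_0,\sigma^2$.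
   Context: Let $f_0\ne f_1$ be two known distinct probability density functions on $\mathbb R^k$ (pre- and post-change densities) and let $\ell(x)=\log(f_1(x)/f_0(x))$ be the log-likelihood ratio. For a data sequence $X_1,X_2,\ldots\in\mathbb R^k$, the CUSUM statistics are $S_0=0$ and, for $t\ge1$, $S_t=\max(0,S_{t-1})+\ell(X_t)$. For $\delta\in(0,1)$ define $$A_\delta=\inf\Big\{t:\max_{i=0,1}\mathbf P_{X\sim f_i}\big(2|\ell(X)|\ge t\big)\le\delta/2\Big\}.$$ $\mathrm{Lap}(\beta)$ denotes the Laplace distribution with density $\exp(-|x|/\beta)/(2\beta)$, $\beta>0$ (so it is understood that $A_\delta>0$). The $\delta$-DP-CUSUM procedure uses $\tilde S_t=S_t+Z_t$, where $Z_1,Z_2,\ldots$ are i.i.d. $\mathrm{Lap}(2A_\delta/\epsilon)$, and a single $W\sim\mathrm{Lap}(2A_\delta/\epsilon)$; $(Z_t)_{t\ge1}$, $W$ and the data are mutually independent. The stopping time with deterministic threshold $b$ is $\tilde T(b)=\inf\{t>0:\tilde S_t\ge b+W\}$. For $\tau\in\{0,1,2,\ldots\}$, $\mathbf E_\tau$ denotes expectation under the joint law in which the $X_t$ are independent, $X_1,\dots,X_\tau$ have density $f_0$, $X_{\tau+1},X_{\tau+2},\ldots$ have density $f_1$, together with the Laplace noises above. The worst-case average detection delay is $$\mathrm{WADD}(\tilde T(b))=\sup_{\tau\ge0}\ \mathrm{ess\,sup}\ \mathbf E_\tau\big[(\tilde T(b)-\tau)^+\mid X_1,\dots,X_\tau\big].$$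 *)

(* Defs.v *)
From HB Require Import structures.
From mathcomp Require Import all_boot all_order all_algebra finmap.
From mathcomp Require Import all_classical all_reals all_analysis.
From mathcomp Require Import measurable_realfun ess_sup_inf.

Set Implicit Arguments.
Unset Strict Implicit.
Unset Printing Implicit Defensive.

Import Order.TTheory GRing.Theory Num.Theory.
Import numFieldNormedType.Exports.

Local Open Scope classical_set_scope.
Local Open Scope ring_scope.

(* R^k with the product of the Borel sigma-algebras.  The library has no
   Lebesgue measure on it; the one below is the image of the iterated product
   measure, and is characterized by its values on boxes (lebesgue_tuple_box). *)
Notation Rn k R := (k.-tuple (measurableTypeR R)).

Section lebesgue_tuple.
Context {R : realType}.
Local Notation BR := (measurableTypeR R).

Definition tuple_cons {k} (p : BR * k.-tuple BR) : k.+1.-tuple BR :=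
  [tuple of p.1 :: p.2].

Definition tuple_uncons {k} (x : k.+1.-tuple BR) : BR * k.-tuple BR :=
  (thead x, [tuple of behead x]).

Lemma tuple_consK k : cancel (@tuple_cons k) tuple_uncons.
Proof. by case=> a t; congr pair; apply/val_inj. Qed.

Lemma measurable_tuple_cons k : measurable_fun setT (@tuple_cons k).
Proof. exact: measurable_cons. Qed.

Lemma measurable_tuple_uncons k : measurable_fun setT (@tuple_uncons k).
Proof.
apply/measurable_fun_pairP; split; last exact: measurable_behead.
exact: (@measurable_tnth _ BR k.+1 ord0).
Qed.

Section step.
Variables (k : nat) (m : {sigma_finite_measure set (k.-tuple BR) -> \bar R}).

Definition lebesgue_tuple_step : set (k.+1.-tuple BR) -> \bar R :=
  pushforward (lebesgue_measure \x m)%E tuple_cons.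

HB.instance Definition _ := Measure.copy lebesgue_tuple_step
  (measure_function_pushforward__canonical__measure_function_Measure
    (lebesgue_measure \x m : {measure set _ -> \bar _})%E
    (@measurable_tuple_cons k)).

Lemma lebesgue_tuple_step_sigma_finite : sigma_finite setT lebesgue_tuple_step.
Proof.
have /sigma_finiteP[F [TF ndF Foo]] := sigma_finiteT (@lebesgue_measure R).
have /sigma_finiteP[G [TG ndG Goo]] := sigma_finiteT m.
exists (fun n => tuple_uncons @^-1` (F n `*` G n)).
  apply/seteqP; split => // x _.
  have [i _ Fi] : (\bigcup_i F i) (tuple_uncons x).1 by rewrite -TF.
  have [j _ Gj] : (\bigcup_j G j) (tuple_uncons x).2 by rewrite -TG.
  exists (maxn i j) => //; split.
  - by move: Fi; exact/subsetPset/ndF/leq_maxl.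
  - by move: Gj; exact/subsetPset/ndG/leq_maxr.
move=> n; have [mF Fn] := Foo n; have [mG Gn] := Goo n; split.
  rewrite -[X in measurable X]setTI; apply: measurable_tuple_uncons => //.
  exact: measurableX.
rewrite /lebesgue_tuple_step /pushforward -comp_preimage.
rewrite (_ : _ \o _ = id) ?preimage_id; last first.
  by apply/funext => p; exact: tuple_consK.
by rewrite product_measure1E// lte_mul_pinfty// ge0_fin_numE.
Qed.

HB.instance Definition _ := Measure_isSigmaFinite.Build _ _ _
  lebesgue_tuple_step lebesgue_tuple_step_sigma_finite.

End step.

Fixpoint lebesgue_tuple (k : nat) :
    {sigma_finite_measure set (k.-tuple BR) -> \bar R} :=
  match k with
  | 0 => \d_([tuple] : 0.-tuple BR)
  | k'.+1 => lebesgue_tuple_step (lebesgue_tuple k')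
  end.

Lemma lebesgue_tuple_box k (B : 'I_k -> set BR) :
  (forall i, measurable (B i)) ->
  lebesgue_tuple k [set x | forall i, B i (tnth x i)] =
  (\prod_(i < k) lebesgue_measure (B i))%E.
Proof.
elim: k B => [|k IH] B mB /=.
  by rewrite big_ord0 diracE mem_set// => -[].
rewrite big_ord_recl -(IH (fun i => B (lift ord0 i)))//.
rewrite /lebesgue_tuple_step /pushforward.
set C := [set x : k.-tuple BR | _].
have mC : measurable C.
  rewrite (_ : C = \bigcap_(i in [set: 'I_k])
    (@tnth k BR ^~ i @^-1` B (lift ord0 i))).
    apply: fin_bigcap_measurable => // i _.
    by rewrite -[X in measurable X]setTI; exact: measurable_tnth.
  by apply/seteqP; split => x Cx i //=; exact: Cx.
rewrite -product_measure1E//; congr (product_measure1 _ _ _).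
apply/seteqP; split => [[a t] /= H|[a t] /= [Ba Ct] i].
  by split => [|i]; [exact: (H ord0)|have := H (lift ord0 i); rewrite tnthS].
by have [j ->|->//] := unliftP ord0 i; rewrite ?tnthS; exact: Ct.
Qed.

End lebesgue_tuple.

Section probability_notions.
Context {d : measure_display} {Omega : measurableType d} {R : realType}.
Variable P : probability Omega R.

Definition has_density {d' : measure_display} {T : measurableType d'}
    (mu : {measure set T -> \bar R}) (X : Omega -> T) (f : T -> R) :=
  forall B, measurable B -> P (X @^-1` B) = (\int[mu]_(x in B) (f x)%:E)%E.

Definition sigma_of {d' : measure_display} {T : measurableType d'}
    (X : Omega -> T) : set (set Omega) :=
  preimage_set_system setT X measurable.

Definition mutually_independent {I : choiceType} (F : I -> set (set Omega)) :=
  forall (J : {fset I}) (E : I -> set Omega),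
    (forall i, i \in J -> F i (E i)) ->
    P (\bigcap_(i in [set` J]) E i) = (\prod_(i <- J) fine (P (E i)))%:E.

(* Y is a version of E[U | G], for U nonnegative, possibly +oo. *)
Definition is_condexp (G : set (set Omega)) (U Y : Omega -> \bar R) :=
  [/\ forall B : set (\bar R), measurable B -> G (Y @^-1` B),
      forall w, (0 <= Y w)%E
    & forall A, G A -> (\int[P]_(w in A) Y w = \int[P]_(w in A) U w)%E].

End probability_notions.

Section densities.
Context {R : realType} {k : nat}.
Local Notation Rk := (Rn k R).

Definition is_pdf (f : Rk -> R) :=
  [/\ measurable_fun setT f, forall x, 0 <= f x
    & (\int[lebesgue_tuple k]_x (f x)%:E = 1)%E].

Definition pr_pdf (f : Rk -> R) (A : set Rk) : \bar R :=
  (\int[lebesgue_tuple k]_(x in A) (f x)%:E)%E.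

Definition expect_pdf (f : Rk -> R) (g : Rk -> \bar R) : \bar R :=
  (\int[lebesgue_tuple k]_x (g x * (f x)%:E))%E.

(* "g(X) is s2-sub-Gaussian under X ~ f"; the mean is required to exist. *)
Definition sub_gaussian (f : Rk -> R) (g : Rk -> \bar R) (s2 : R) :=
  (lebesgue_tuple k).-integrable setT (fun x => (g x * (f x)%:E)%E) /\
  forall lambda : R,
    (expect_pdf f (fun x => expeR (lambda%:E * (g x - expect_pdf f g)))
     <= (expR (lambda ^+ 2 * s2 / 2))%:E)%E.

(* Extended-real valued: x / 0 = +oo for x > 0, and lne 0 = -oo.  Where both
   densities vanish the value is -oo; this set is null under both laws. *)
Definition llr (f0 f1 : Rk -> R) (x : Rk) : \bar R :=
  lne ((f1 x)%:E / (f0 x)%:E)%E.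

Fixpoint cusum (f0 f1 : Rk -> R) (x : nat -> Rk) (t : nat) : \bar R :=
  match t with
  | 0 => 0%E
  | t'.+1 => (maxe 0 (cusum f0 f1 x t') + llr f0 f1 (x t))%E
  end.

Definition A_of (f0 f1 : Rk -> R) (delta : R) : R :=
  inf [set t : R |
    (maxe (pr_pdf f0 [set x | t%:E <= 2%:E * `|llr f0 f1 x|])
          (pr_pdf f1 [set x | t%:E <= 2%:E * `|llr f0 f1 x|])
     <= (delta / 2)%:E)%E].

Definition I0_of (f0 f1 : Rk -> R) : R := fine (expect_pdf f1 (llr f0 f1)).

End densities.

Definition laplace_pdf {R : realType} (beta x : R) : R :=
  expR (- `|x| / beta) / (2 * beta).

Section dp_cusum.
Context {R : realType} {k : nat} {d : measure_display} {Omega : measurableType d}.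
(* Time starts at 1: X 0 and Z 0 are never used. *)
Variables (X : nat -> {mfun Omega >-> Rn k R})
  (Z : nat -> {mfun Omega >-> R}) (W : {mfun Omega >-> R}).

Definition sources (i : nat + nat + unit) : set (set Omega) :=
  match i with
  | inl (inl t) => sigma_of (X t.+1)
  | inl (inr t) => sigma_of (Z t.+1)
  | inr _ => sigma_of W
  end.

Definition change_point_law (P : probability Omega R) (tau : nat)
    (f0 f1 : Rn k R -> R) (beta : R) :=
  [/\ forall t, (0 < t)%N ->
        has_density P (lebesgue_tuple k) (X t) (if (t <= tau)%N then f0 else f1),
      forall t, (0 < t)%N ->
        has_density P lebesgue_measure (Z t) (laplace_pdf beta),
      has_density P lebesgue_measure W (laplace_pdf beta)
    & mutually_independent P sources].

Definition dp_stop (f0 f1 : Rn k R -> R) (b : R) (w : Omega) : \bar R :=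
  ereal_inf [set t%:R%:E | t in [set t : nat | (0 < t)%N /\
    ((b + W w)%:E <= cusum f0 f1 (X ^~ w) t + (Z t w)%:E)%E]].

Definition past (tau : nat) : set (set Omega) :=
  <<s \bigcup_(t in [set t | (0 < t <= tau)%N]) sigma_of (X t) >>.

(* A version Y of the conditional expectation always exists since (T - tau)^+
   is nonnegative, and its essential supremum does not depend on the version. *)
Definition WADD (P : nat -> probability Omega R) (T : Omega -> \bar R) : \bar R :=
  ereal_sup [set e | exists (tau : nat) (Y : Omega -> \bar R),
    is_condexp (P tau) (past tau) (fun w => maxe (T w - tau%:R%:E) 0)%E Y /\
    e = ess_sup (P tau) Y].

End dp_cusum.

(* Main.v *)
Require Import Defs.
From HB Require Import structures.
From mathcomp Require Import all_boot all_order all_algebra finmap.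
From mathcomp Require Import all_classical all_reals all_analysis.
From mathcomp Require Import measurable_realfun ess_sup_inf.
From mathcomp Require Import ring lra.

Set Implicit Arguments.
Unset Strict Implicit.
Unset Printing Implicit Defensive.

Import Order.TTheory GRing.Theory Num.Theory.
Import numFieldNormedType.Exports.

Local Open Scope classical_set_scope.
Local Open Scope ring_scope.

(** After the change point, the CUSUM statistic dominates the random walk U_n of
    log-likelihood ratios, whose increments have mean I0 > 0 (cusum_ge_walk).
    A delay larger than n therefore forces U_n + Z_{tau+n} < b + W, and the
    integral of the delay over an event A of the past is at most P(A) plus the sum over
    n >= 1 of P(A, U_n + Z_{tau+n} < b + W) (delay_le). The noise Z_{tau+n} is
    independent of the other variables of the n-th term, and it may be replaced
    there by Z_1 (alive_swap). What remains is the mean number of visits of the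
    walk to a half-line, up to a level b + W - Z_1 independent of the walk.

    This number is at most level / I0 plus a constant, by a Lyapunov argument.
    For the gap y between the level and the walk, consider

      gap_potential(y) = max(y, 0) / I0 + K laplace_primitive(y).

    The linear part decreases on average by 1 per step when y > 0, up to an
    error of order exp(- th |y|) created by the kink at 0. The walk is
    transient, since exp(- th U_n) has a geometrically decreasing mean for a
    small th, and this makes the mean of the bounded part decrease by a
    multiple of exp(- th |y|) (laplace_primitive_drop). For K large enough,
    the mean of the potential thus decreases by at least 1 on y > 0 and never
    increases (gap_potential_drift). Telescoping bounds the number of visits by
    the mean potential of b + W - Z_1, hence by
    (b + E|W| + E|Z_1|) / I0 + 2 K (sum_alive_bound).

    The constant involves only eps, delta, I0 and sigma^2: th and K come from
    the sub-Gaussian bounds under f1, and the noise scale 2 A / eps is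
    controlled by an exponential tail bound on the log-likelihood ratio under
    both densities (A_of_le_bound). Positivity of I0 is the strict Gibbs
    inequality (I0_gt0). All bounds hold on every event A of the past with the
    factor P(A), which bounds the essential supremum of the conditional
    expectation (condexp_ess_sup_le); the term in sqrt(b), being nonnegative,
    only enlarges the final bound. *)

(** * A Lyapunov function for random walks with positive drift *)

Section potential.
Context {R : realType}.
Implicit Types th y s : R.

(** Twice the distribution function of the Laplace law of scale 1/th, that is
    th times the primitive of exp(- th |.|) that vanishes at -oo. *)
Definition laplace_primitive th y : R :=
  if y <= 0 then expR (th * y) else 2 - expR (- (th * y)).

Lemma laplace_primitive_ge0 th y : 0 <= th -> 0 <= laplace_primitive th y.
Proof.
rewrite /laplace_primitive => th0; case: ifPn => [_|]; first exact: expR_ge0.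
rewrite -ltNge => y0.
have : expR (- (th * y)) <= 1 by rewrite -expR0 ler_expR oppr_le0 mulr_ge0// ltW.
lra.
Qed.

Lemma laplace_primitive_le2 th y : 0 <= th -> laplace_primitive th y <= 2.
Proof.
rewrite /laplace_primitive => th0; case: ifPn => [y0|_]; last first.
  by rewrite lerBlDr lerDl expR_ge0.
have : expR (th * y) <= 1 by rewrite -expR0 ler_expR mulr_ge0_le0.
lra.
Qed.

(** Since exp(- th |v|) is th-Lipschitz on the logarithmic scale, integrating
    it over a step of signed length s starting at y changes the primitive as
    if the weight were exp(- th |y|) exp(- th r) after a distance r: a lower
    bound forwards and an upper bound backwards, hence a single formula for
    both signs of s. *)
Lemma laplace_primitive_drop th y s : 0 <= th ->
  expR (- (th * `|y|)) * (1 - expR (- (th * s))) <=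
  laplace_primitive th y - laplace_primitive th (y - s).
Proof.
move=> th0; pose p := expR (- (th * y)); pose v := expR (th * (y - s)).
pose q := expR (- (th * (y - s))); pose u := expR (th * y).
have p0 : 0 < p by exact: expR_gt0.
have v0 : 0 < v by exact: expR_gt0.
have q0 : 0 < q by exact: expR_gt0.
have vq : v * q = 1 by rewrite /v /q expRN mulfV// gt_eqF// expR_gt0.
have up : u * p = 1 by rewrite /u /p expRN mulfV// gt_eqF// expR_gt0.
have -> : expR (- (th * s)) = v * p by rewrite /v /p -expRD; congr expR; ring.
rewrite /laplace_primitive -/u -/p -/q -/v; case: ifPn => [y0|]; last first.
  rewrite -ltNge => y0; rewrite gtr0_norm// -/p.
  have p1 : p <= 1 by rewrite /p -expR0 ler_expR oppr_le0 mulr_ge0// ltW.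
  case: ifPn => [ys|].
    have v1 : v <= 1 by rewrite /v -expR0 ler_expR mulr_ge0_le0.
    (* With p, v <= 1 the claim is 0 <= (1 - p) (2 - v (1 + p)). *)
    have : 0 <= (1 - p) * (2 - v * (1 + p)).
      apply: mulr_ge0; first lra.
      by have := ler_pM (ltW v0) (addr_ge0 ler01 (ltW p0)) v1 (lexx _); lra.
    lra.
  move=> _; have : 0 <= v * (p - q) ^+ 2 by rewrite mulr_ge0 ?sqr_ge0 ?ltW.
  have -> : v * (p - q) ^+ 2 = p * (v * p) - 2 * p * (v * q) + q * (v * q) by ring.
  rewrite vq; lra.
rewrite ler0_norm// mulrN opprK -/u.
have -> : u * (1 - v * p) = u - v * (u * p) by ring.
rewrite up mulr1; case: ifPn => // _.
suff : 2 <= v + q by lra.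
have : 0 <= q * (v - 1) ^+ 2 by rewrite mulr_ge0 ?sqr_ge0 ?ltW.
have -> : q * (v - 1) ^+ 2 = v * (v * q) - 2 * (v * q) + q by ring.
rewrite vq; lra.
Qed.

(** The linear part counts the steps of mean I still needed to bring the gap y
    down to 0; the bounded part absorbs the error that the kink of max(y, 0)
    causes near 0. *)
Definition gap_potential th I K y : R := Num.max y 0 / I + K * laplace_primitive th y.

Lemma gap_potential_ge0 th I K y : 0 <= th -> 0 <= I -> 0 <= K ->
  0 <= gap_potential th I K y.
Proof.
move=> th0 I0 K0; rewrite addr_ge0 ?mulr_ge0 ?invr_ge0 ?laplace_primitive_ge0//.
by rewrite le_max lexx orbT.
Qed.

(** The kink of max(y, 0) costs (s - y)^+ or (y - s)^+, according to the side
    where y lies, and x <= exp(th x) / th makes either cost decay like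
    exp(- th |y|), which is the order of the gain provided by laplace_primitive_drop. *)
Lemma gap_potential_step th I K y s : 0 < th -> 0 < I -> 0 <= K ->
  gap_potential th I K (y - s) <= gap_potential th I K y - (0 < y)%R%:R / I * s
    + expR (- (th * `|y|)) * ((expR (th * s) + expR (- (th * s))) / (th * I)
                              - K * (1 - expR (- (th * s)))).
Proof.
move=> th0 I0 K0; set e := expR (- (th * `|y|)); set c := expR (th * s).
set d := expR (- (th * s)).
have e0 : 0 < e by exact: expR_gt0.
have c0 : 0 < c by exact: expR_gt0.
have d0 : 0 < d by exact: expR_gt0.
have Kprim : K * laplace_primitive th (y - s) <=
    K * laplace_primitive th y - K * (e * (1 - d)).
  by rewrite -mulrBr ler_wpM2l// lerBrDl -lerBrDr laplace_primitive_drop// ltW.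
suff : Num.max (y - s) 0 / I <= Num.max y 0 / I - (0 < y)%R%:R / I * s
    + e * (c + d) / (th * I).
  rewrite /gap_potential; have -> : e * ((c + d) / (th * I) - K * (1 - d)) =
    e * (c + d) / (th * I) - K * (e * (1 - d)) by ring.
  lra.
suff H : Num.max (y - s) 0 <= Num.max y 0 - (0 < y)%R%:R * s + e * (c + d) / th.
  have -> : Num.max y 0 / I - (0 < y)%R%:R / I * s + e * (c + d) / (th * I) =
    (Num.max y 0 - (0 < y)%R%:R * s + e * (c + d) / th) / I.
    by field; rewrite !gt_eqF.
  by rewrite ler_pM2r// invr_gt0.
have le1 x : x <= expR (th * x) / th.
  rewrite ler_pdivlMr// mulrC; have := expR_ge1Dx (th * x); lra.
have ecd : 0 <= e * (c + d) / th by rewrite mulr_ge0 ?invr_ge0 ?mulr_ge0 ?addr_ge0 ?ltW.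
have [y0|y0] := ltP 0 y; rewrite ?mul1r ?mul0r ?subr0 ?add0r ge_max;
  apply/andP; split => //.
- lra.
- suff : s - y <= e * (c + d) / th by lra.
  apply: le_trans (le1 (s - y)) _; rewrite ler_pM2r ?invr_gt0//.
  have -> : expR (th * (s - y)) = e * c.
    by rewrite /e /c -expRD gtr0_norm//; congr expR; ring.
  by rewrite ler_pM2l// lerDl ltW.
- apply: le_trans (le1 (y - s)) _; rewrite ler_pM2r ?invr_gt0//.
  have -> : expR (th * (y - s)) = e * d.
    by rewrite /e /d -expRD ler0_norm//; congr expR; ring.
  by rewrite ler_pM2l// lerDr ltW.
Qed.

Lemma gap_potential_le th I K y z : 0 <= th -> 0 < I -> 0 <= K -> 0 <= z -> y <= z ->
  gap_potential th I K y <= z / I + 2 * K.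
Proof.
move=> th0 I0 K0 z0 yz; rewrite lerD//.
  by rewrite ler_pM2r ?invr_gt0// ge_max yz z0.
by rewrite mulrC ler_wpM2r// laplace_primitive_le2.
Qed.

Lemma measurable_gap_potential th I K : measurable_fun setT (gap_potential th I K).
Proof.
rewrite /gap_potential; apply: measurable_funD.
  apply: measurable_funM => //; exact: measurable_maxr.
apply: measurable_funM => //; rewrite /laplace_primitive.
apply: measurable_fun_ifT => //=.
- exact: measurable_fun_ler.
- by apply: measurableT_comp => //; exact: measurable_funM.
- apply: measurable_funB => //; apply: measurableT_comp => //.
  by apply: measurableT_comp => //; exact: measurable_funM.
Qed.

End potential.

(** * Integration against densities, conditional expectation, independence *)

Section integral_tools.
Context {d : measure_display} {T : measurableType d} {R : realType}.

Lemma measurable_bool_real (g : T -> bool) :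
  measurable_fun setT g -> measurable_fun setT (fun x => (g x)%:R : R).
Proof.
by move=> mg; apply: (@measurableT_comp _ _ _ _ _ _ (fun c : bool => c%:R : R)).
Qed.

Local Open Scope ereal_scope.

(** Every simple function below f is below g. This monotonicity is applied to
    integrands, such as the detection delay, whose measurability is not
    established. *)
Lemma ge0_integral_mono (mu : {measure set T -> \bar R}) (f g : T -> \bar R) :
  (forall x, 0 <= f x) -> (forall x, f x <= g x) ->
  \int[mu]_x f x <= \int[mu]_x g x.
Proof.
move=> f0 fg; rewrite !ge0_integralTE//; last by move=> x; exact: le_trans (fg x).
apply: le_ereal_sup => _ [h hf <-].
by exists h => // x; exact: le_trans (fg x).
Qed.

(** By uniqueness of the Radon-Nikodym derivative, f is almost everywhere the
    derivative of the law of X with respect to mu. *)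
Lemma ge0_integral_density {d' : measure_display} {T' : measurableType d'}
    (P : probability T R) (mu : {sigma_finite_measure set T' -> \bar R})
    (X : {mfun T >-> T'}) (f : T' -> R) (g : T' -> \bar R) :
  has_density P mu X f -> measurable_fun setT f -> (forall x, 0 <= f x)%R ->
  measurable_fun setT g -> (forall x, 0 <= g x) ->
  \int[P]_w g (X w) = \int[mu]_x (g x * (f x)%:E).
Proof.
move=> Xf mf f0 mg g0.
rewrite -(ge0_integral_distribution (X : {RV P >-> T'}))//.
have mfE : measurable_fun setT (EFin \o f) by exact/measurable_EFinP.
have Pmu : distribution P X `<< mu.
  apply/null_content_dominatesP => B mB B0; rewrite /distribution /pushforward Xf//.
  by apply: null_set_integral => //; exact: measurable_funTS.
rewrite -(Radon_Nikodym_SigmaFinite.change_of_variables Pmu)//.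
apply: ae_eq_integral => //.
- apply: emeasurable_funM => //.
  exact: measurable_int (Radon_Nikodym_SigmaFinite.f_integrable Pmu).
- exact: emeasurable_funM.
apply: ae_eqe_mul2l; apply: integral_ae_eq => //.
  exact: Radon_Nikodym_SigmaFinite.f_integrable.
move=> E _ mE; rewrite -Radon_Nikodym_SigmaFinite.f_integral//.
by rewrite /= /distribution /pushforward Xf.
Qed.

End integral_tools.

Section sigma_of.
Context {d : measure_display} {Omega : measurableType d}.

Lemma sigma_of_measurable {d' : measure_display} {T : measurableType d'}
  (Y : {mfun Omega >-> T}) : sigma_of Y `<=` measurable.
Proof. by move=> _ [B mB <-]; exact: measurable_funP. Qed.

Lemma setI_closed_sigma_of {d' : measure_display} {T : measurableType d'}
  (Y : Omega -> T) : setI_closed (sigma_of Y).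
Proof.
move=> _ _ [B mB <-] [C mC <-]; exists (B `&` C); first exact: measurableI.
by rewrite preimage_setI setIACA setIid.
Qed.

Lemma sigma_ofT {d' : measure_display} {T : measurableType d'}
  (Y : Omega -> T) : sigma_of Y setT.
Proof. by exists setT => //; rewrite preimage_setT setTI. Qed.

End sigma_of.

Section independence.
Context {d : measure_display} {Omega : measurableType d} {R : realType}.
Variable P : probability Omega R.
Local Open Scope ereal_scope.

(** A pi-lambda argument: finite intersections of members of the F j, j != i,
    form a pi-system on which the product rule with B is the assumption. Such
    an intersection is encoded by a family E equal to setT outside a finite
    set, so that intersecting two of them is done componentwise. *)
Lemma mutually_independent_others {I : choiceType} (F : I -> set (set Omega))
    (i : I) (A B : set Omega) :
  (forall j, F j `<=` measurable) -> (forall j, setI_closed (F j)) ->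
  (forall j, F j setT) -> mutually_independent P F ->
  <<s \bigcup_(j in [set j | j != i]) F j >> A -> F i B ->
  P (A `&` B) = P A * P B.
Proof.
move=> mF IF TF indF sA FB.
have mB : measurable B by exact: mF FB.
pose G : set (set Omega) := [set A | exists (K : {fset I}) (E : I -> set Omega),
  [/\ i \notin K, forall j, F j (E j), forall j, j \notin K -> E j = setT &
      A = \bigcap_(j in [set` K]) E j]].
have capT K (E : I -> set Omega) : (forall j, j \notin K -> E j = setT) ->
    \bigcap_(j in [set` K]) E j = \bigcap_j E j.
  move=> ET; apply/seteqP; split => w Ew j _; last exact: Ew.
  by have [jK|jK] := boolP (j \in K); [exact: Ew|rewrite ET].
have GI : setI_closed G.
  move=> _ _ [K1 [E1 [iK1 FE1 TE1 ->]]] [K2 [E2 [iK2 FE2 TE2 ->]]].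
  exists (K1 `|` K2)%fset, (fun j => E1 j `&` E2 j); split.
  - by rewrite inE negb_or iK1.
  - by move=> j; exact: IF.
  - by move=> j; rewrite inE negb_or => /andP[j1 j2]; rewrite TE1// TE2// setTI.
  - rewrite !capT ?bigcapI// => j; rewrite inE negb_or => /andP[j1 j2].
    by rewrite TE1// TE2// setTI.
have mG : G `<=` measurable.
  move=> _ [K [E [_ FE _ ->]]]; rewrite bigcap_fset; apply: bigsetI_measurable => j _.
  exact: mF (FE j).
have GT : G setT.
  exists fset0, (fun=> setT); split => //.
  by rewrite set_fset0 bigcap_set0.
have sub : \bigcup_(j in [set j | j != i]) F j `<=` G.
  move=> C [j /= ji FC]; exists [fset j]%fset, (fun l => if l == j then C else setT).
  split.
  - by rewrite inE eq_sym.
  - by move=> l; case: eqP => // ->.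
  - by move=> l; rewrite inE => /negbTE ->.
  - by rewrite set_fset1 bigcap_set1 eqxx.
have PB0 : (0 <= fine (P B))%R by exact: fine_ge0.
transitivity (mrestr P mB A); first by [].
rewrite muleC -[P B]fineK ?fin_num_measure//.
transitivity (mscale (NngNum PB0) P A); last by [].
apply: (g_sigma_algebra_measure_unique G mG (fun=> setT)) => //.
- by rewrite bigcup_const.
- move=> _ [K [E [iK FE _ ->]]].
  change (P (\bigcap_(j in [set` K]) E j `&` B) =
    (fine (P B))%:E * P (\bigcap_(j in [set` K]) E j)); rewrite setIC.
  pose E' j := if j == i then B else E j.
  have E'E j : j \in K -> E' j = E j.
    by move=> jK; rewrite /E'; case: eqP => // ji; rewrite -ji jK in iK.
  have -> : \bigcap_(j in [set` K]) E j = \bigcap_(j in [set` K]) E' j.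
    by apply: eq_bigcapr => j /E'E ->.
  have E'i : E' i = B by rewrite /E' eqxx.
  have FE' j : F j (E' j) by rewrite /E'; case: eqP => [->|].
  rewrite -{1}E'i -bigcap_fsetU1 !indF// big_fsetU1//= E'i EFinM.
  by rewrite fineK// fin_num_measure.
- move=> _; change (P (setT `&` B) < +oo).
  by rewrite setTI ltey_eq fin_num_measure.
- apply: smallest_sub sA; first exact: smallest_sigma_algebra.
  by apply: subset_trans sub _; exact: sub_sigma_algebra.
Qed.

(** Independence of X from the sigma-algebra generated by G means that the
    pair (identity, X), the first component being valued in Omega equipped
    with that sigma-algebra, has a product law. Everything known before X is
    thus handled at once, without naming the variables it depends on. *)
Lemma independent_fubini {d' : measure_display} {T : measurableType d'}
    (G : set (set Omega)) (X : {mfun Omega >-> T})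
    (h : g_sigma_algebraType G * T -> \bar R) :
  <<s G >> `<=` measurable ->
  (forall A B, <<s G >> A -> measurable B ->
     P (A `&` X @^-1` B) = P A * P (X @^-1` B)) ->
  measurable_fun setT h -> (forall z, 0 <= h z) ->
  \int[P]_w h (w, X w) = \int[P]_w \int[distribution P X]_x h (w, x).
Proof.
move=> mG ind mh h0.
have mid : measurable_fun setT (id : Omega -> g_sigma_algebraType G).
  by move=> _ B mB; rewrite setTI preimage_id; exact: mG.
pose Pid : {mfun Omega >-> g_sigma_algebraType G} :=
  HB.pack (id : Omega -> g_sigma_algebraType G) (isMeasurableFun.Build _ _ _ _ _ mid).
have mp : measurable_fun setT (fun w => (Pid w, X w)).
  by apply: measurable_fun_pair.
pose pX : {mfun Omega >-> (g_sigma_algebraType G * T)%type} :=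
  HB.pack (fun w => (Pid w, X w)) (isMeasurableFun.Build _ _ _ _ _ mp).
rewrite -[LHS](ge0_integral_distribution (pX : {RV P >-> _}))//.
transitivity (\int[distribution P Pid \x distribution P X]_z h z).
  apply: eq_measure_integral => A mA _; apply/esym.
  apply: (@product_measure_unique _ _ _ _ _ (distribution P Pid)
    (distribution P X) (distribution P pX)) mA.
  by move=> B C mB mC; rewrite /= /distribution /pushforward /=; exact: ind.
rewrite fubini_tonelli1//.
rewrite (ge0_integral_distribution (Pid : {RV P >-> _}))//.
  exact: measurable_fun_fubini_tonelli_F.
by move=> y; exact: integral_ge0.
Qed.

End independence.

Section signed_density.
Context {d : measure_display} {T : measurableType d} {R : realType}.
Local Open Scope ereal_scope.

Lemma integral_density {d' : measure_display} {T' : measurableType d'}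
    (P : probability T R) (mu : {sigma_finite_measure set T' -> \bar R})
    (X : {mfun T >-> T'}) (f g : T' -> R) :
  has_density P mu X f -> measurable_fun setT f -> (forall x, 0 <= f x)%R ->
  measurable_fun setT g ->
  mu.-integrable setT (fun x => (g x * f x)%:E) ->
  (distribution P X).-integrable setT (EFin \o g) /\
  \int[distribution P X]_x (g x)%:E = \int[mu]_x (g x * f x)%:E.
Proof.
move=> Xf mf f0 mg ig.
have mgE : measurable_fun setT (EFin \o g) by exact/measurable_EFinP.
have dens (h : T' -> \bar R) : measurable_fun setT h -> (forall x, 0 <= h x) ->
    \int[distribution P X]_x h x = \int[mu]_x (h x * (f x)%:E).
  move=> mh h0; rewrite -(ge0_integral_density Xf)//.
  by rewrite (ge0_integral_distribution (X : {RV P >-> T'})).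
split.
  apply/integrableP; split => //; rewrite dens//; last exact: measurableT_comp.
  case/integrableP: ig => _; congr (_ < _); apply: eq_integral => x _.
  by rewrite /= -EFinM normrM (ger0_norm (f0 x)).
rewrite integralE [RHS]integralE dens//; last exact: measurable_funepos.
rewrite dens//; last exact: measurable_funeneg.
congr (_ - _); apply: eq_integral => x _.
  by rewrite !funeposE -!EFin_max -EFinM maxr_pMl// mul0r.
by rewrite !funenegE -!EFinN -!EFin_max -EFinM maxr_pMl// mul0r mulNr.
Qed.

(** Test the defining property of Y on the event Y > c. *)
Lemma condexp_ess_sup_le (P : probability T R) (G : set (set T))
    (U Y : T -> \bar R) (c : R) : (0 <= c)%R ->
  G `<=` measurable -> is_condexp P G U Y ->
  (forall A, G A -> \int[P]_(w in A) U w <= c%:E * P A) ->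
  ess_sup P Y <= c%:E.
Proof.
move=> c0 mG [GY Y0 EY] HU; apply/ess_supP.
have mY : measurable_fun setT Y by move=> _ B mB; rewrite setTI; exact/mG/GY.
apply/ae_le_measureP => //; set A := Y @^-1` _.
have GA : G A by apply: GY; exact: emeasurable_itv.
have mA := mG _ GA.
have PAfin : P A \is a fin_num by exact: fin_num_measure.
pose g w := Y w - c%:E.
have gpos w : A w -> 0 < g w.
  by rewrite /A/= in_itv/= andbT => cY; rewrite sube_gt0.
have mg : measurable_fun A g.
  by apply: emeasurable_funB => //; exact: measurable_funTS.
have ig : \int[P]_(w in A) g w <= 0.
  rewrite -(leeD2rE _ _ (x := c%:E * P A)); last by rewrite fin_numM.
  rewrite add0e -{1}(integral_cst P mA) -ge0_integralD//; last first.
    by move=> w /gpos/ltW.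
  apply: le_trans (HU _ GA); rewrite -EY//.
  rewrite le_eqVlt; apply/orP; left; apply/eqP; apply: eq_integral => w _.
  by rewrite /g subeK.
have ig0 : \int[P]_(w in A) `|g w| = 0.
  apply/eqP; rewrite eq_le integral_ge0// andbT.
  by rewrite (eq_integral g)// => w; rewrite inE => /gpos/ltW/gee0_abs.
have /(ae_eq_integral_abs P mA mg) := ig0.
move=> [N [mN N0 AN]]; apply: (subset_measure0 mA mN) => // w Aw.
by apply: AN => /= /(_ Aw) gw; move: (gpos _ Aw); rewrite gw ltxx.
Qed.

End signed_density.

(** * Expected drift, and moments of the Laplace law *)

Section drift.
Context {d : measure_display} {T : measurableType d} {R : realType}.
Variables (Q : probability T R) (L : T -> R) (th I M rho K : R).
Hypotheses (mL : measurable_fun setT L) (intL : Q.-integrable setT (EFin \o L)).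
Hypothesis EL : (\int[Q]_x (L x)%:E = I%:E)%E.
Hypothesis EexpL : (\int[Q]_x (expR (th * L x))%:E <= M%:E)%E.
Hypothesis EexpNL : (\int[Q]_x (expR (- (th * L x)))%:E <= rho%:E)%E.
Hypotheses (th0 : 0 < th) (I0 : 0 < I) (K0 : 0 <= K).
Hypothesis KM : (M + rho) / (th * I) <= K * (1 - rho).

(** The expectation of gap_potential_step: the linear part loses I / I = 1 when
    y > 0, and K is large enough for the remaining term, a multiple of
    exp(- th |y|), to be nonpositive. *)
Lemma gap_potential_drift y :
  (\int[Q]_x (gap_potential th I K (y - L x))%:E + ((0 < y)%R%:R)%:E
    <= (gap_potential th I K y)%:E)%E.
Proof.
set e := expR (- (th * `|y|)).
pose c0 := gap_potential th I K y - e * K.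
pose c1 := - ((0 < y)%R%:R / I).
pose c2 := e / (th * I).
pose c3 := e * ((th * I)^-1 + K).
have e0 : 0 < e by exact: expR_gt0.
have thI : 0 < (th * I)^-1 by rewrite invr_gt0 mulr_gt0.
have c20 : 0 <= c2 by apply: mulr_ge0; exact: ltW.
have c30 : 0 <= c3 by apply: mulr_ge0; [exact: ltW|rewrite addr_ge0// ltW].
have mexp : measurable_fun setT (fun x => expR (th * L x)).
  by apply: measurableT_comp => //; exact: measurable_funM.
have mexpN : measurable_fun setT (fun x => expR (- (th * L x))).
  by apply: measurableT_comp => //; apply: measurableT_comp => //;
    exact: measurable_funM.
have iexp : Q.-integrable setT (fun x => (expR (th * L x))%:E).
  apply/integrableP; split; first exact/measurable_EFinP.
  under eq_integral do rewrite gee0_abs ?lee_fin ?expR_ge0//.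
  exact: le_lt_trans EexpL (ltry _).
have iexpN : Q.-integrable setT (fun x => (expR (- (th * L x)))%:E).
  apply/integrableP; split; first exact/measurable_EFinP.
  under eq_integral do rewrite gee0_abs ?lee_fin ?expR_ge0//.
  exact: le_lt_trans EexpNL (ltry _).
pose F x := ((c0%:E + c1%:E * (L x)%:E) +
  (c2%:E * (expR (th * L x))%:E + c3%:E * (expR (- (th * L x)))%:E))%E.
have FE x : F x = (gap_potential th I K y - (0 < y)%R%:R / I * L x + e *
    ((expR (th * L x) + expR (- (th * L x))) / (th * I)
     - K * (1 - expR (- (th * L x)))))%:E.
  rewrite /F -!EFinM -!EFinD; congr EFin.
  by rewrite /c0 /c1 /c2 /c3; field; rewrite !gt_eqF.
have pot0 x : 0 <= gap_potential th I K x by rewrite gap_potential_ge0// ltW.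
have potF x : ((gap_potential th I K (y - L x))%:E <= F x)%E.
  by rewrite FE lee_fin; exact: gap_potential_step.
have mF : measurable_fun setT F.
  apply: emeasurable_funD; apply: emeasurable_funD => //;
    apply: emeasurable_funM => //; exact/measurable_EFinP.
apply: (@le_trans _ _ (\int[Q]_x F x + ((0 < y)%R%:R)%:E)%E).
  rewrite leeD2r//; apply: ge0_integral_mono => // x.
  by rewrite lee_fin.
have icst : Q.-integrable setT (fun=> c0%:E).
  exact: finite_measure_integrable_cst.
rewrite /F integralD//; last 2 first.
- by apply: integrableD => //; exact: integrableZl.
- by apply: integrableD => //; exact: integrableZl.
rewrite integralD//; last exact: integrableZl.
rewrite [X in (_ + X + _ <= _)%E]integralD//; last 2 first.
- exact: integrableZl.
- exact: integrableZl.
rewrite !integralZl// EL.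
have Q1 : Q setT = 1%E by exact: probability_setT.
rewrite integral_cst// [X in (_ * X + _)%E]Q1 mule1.
apply: (@le_trans _ _ ((c0%:E + c1%:E * I%:E + (c2%:E * M%:E + c3%:E * rho%:E))
  + ((0 < y)%R%:R)%:E)%E).
  by rewrite leeD2r// leeD2l// leeD// lee_wpmul2l// lee_fin.
rewrite -!EFinM -!EFinD lee_fin /c0 /c1 /c2 /c3.
have -> : gap_potential th I K y - e * K + - ((0 < y)%R%:R / I) * I +
  (e / (th * I) * M + e * ((th * I)^-1 + K) * rho) + (0 < y)%R%:R =
  gap_potential th I K y + e * ((M + rho) / (th * I) - K * (1 - rho)).
  by field; rewrite !gt_eqF.
by rewrite gerDl mulr_ge0_le0 ?(ltW e0)// subr_le0.
Qed.

End drift.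

Section laplace.
Context {R : realType}.
Implicit Type beta : R.

Lemma laplace_pdf_ge0 beta x : 0 < beta -> 0 <= laplace_pdf beta x.
Proof. by move=> b0; rewrite mulr_ge0 ?expR_ge0 ?invr_ge0 ?mulr_ge0 ?ltW. Qed.

Lemma continuous_laplace_pdf beta : continuous (laplace_pdf beta).
Proof.
move=> x; rewrite /laplace_pdf; apply: cvgM; last exact: cvg_cst.
apply: continuous_comp; last exact: continuous_expR.
apply: cvgM; last exact: cvg_cst.
by apply: cvgN; apply: (@norm_continuous _ R^o).
Qed.

Lemma measurable_laplace_pdf beta : measurable_fun setT (laplace_pdf beta).
Proof. exact: continuous_measurable_fun (@continuous_laplace_pdf _). Qed.

(** By symmetry, twice the integral over the half line, which is half of an
    exponential law. *)
Lemma integral_laplace_pdf beta : 0 < beta ->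
  (\int[lebesgue_measure]_x (laplace_pdf beta x)%:E = 1)%E.
Proof.
move=> b0; rewrite ge0_symfun_integralT//; last 3 first.
- by move=> x; exact: laplace_pdf_ge0.
- exact: continuous_laplace_pdf.
- by move=> x; rewrite /laplace_pdf/= normrN.
rewrite integral_mkcond.
rewrite -(integral_exponential_pdf (rate := beta^-1)) ?invr_gt0//.
rewrite -ge0_integralZl//; last 2 first.
- apply/(measurable_restrictT _ _).1; first by rewrite -set_itvcy.
  by apply: measurable_funTS; apply/measurable_EFinP; exact: measurable_laplace_pdf.
- move=> x _; apply: erestrict_ge0 => // z _.
  by rewrite lee_fin laplace_pdf_ge0.
apply: eq_integral => x _; rewrite patchE /= /exponential_pdf patchE.
rewrite set_itvcy; case: ifPn => [|_]; last by rewrite mule0.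
rewrite inE/= => x0; rewrite -EFinM /laplace_pdf ger0_norm//; congr EFin.
rewrite mulrA -[X in _ = X]mulrC mulNr mulNr (mulrC x); field.
by rewrite gt_eqF.
Qed.

(** The constant 4 comes from u <= exp(u) with u = |x| / (2 beta), which
    compares |x| times the density of scale beta with that of scale 2 beta. *)
Lemma laplace_abs_moment beta : 0 < beta ->
  (\int[lebesgue_measure]_x (`|x|%:E * (laplace_pdf beta x)%:E)
    <= (4 * beta)%:E)%E.
Proof.
move=> b0; rewrite -[leRHS]mule1 -(@integral_laplace_pdf (2 * beta)) ?mulr_gt0//.
rewrite -ge0_integralZl//; last 3 first.
- by apply/measurable_EFinP; exact: measurable_laplace_pdf.
- by move=> x _; rewrite lee_fin laplace_pdf_ge0// mulr_gt0.
- by rewrite lee_fin mulr_ge0// ltW.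
apply: ge0_integral_mono => x; rewrite -EFinM lee_fin.
  by rewrite mulr_ge0// laplace_pdf_ge0.
rewrite /laplace_pdf; set u := `|x| / (2 * beta).
have -> : - `|x| / beta = - u - u by rewrite /u; field; rewrite gt_eqF.
have -> : - `|x| / (2 * beta) = - u by rewrite /u; field; rewrite gt_eqF.
rewrite expRD.
have -> : `|x| * (expR (- u) * expR (- u) / (2 * beta)) =
   (u * expR (- u)) * expR (- u) by rewrite /u; field; rewrite gt_eqF.
have -> : 4 * beta * (expR (- u) / (2 * (2 * beta))) = expR (- u).
  by field; rewrite gt_eqF.
rewrite ler_piMl ?expR_ge0// expRN ler_pdivrMr ?expR_gt0// mul1r.
have := expR_ge1Dx u; lra.
Qed.

End laplace.

(** * The log-likelihood ratio under the two densities *)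

Section log_likelihood_ratio.
Context {R : realType} {k : nat}.
Variables f0 f1 : Rn k R -> R.
Local Notation mu := (lebesgue_tuple k).

(** A real-valued representative of llr: the two agree where both densities are
    positive, and the complement is null under both laws as soon as the mean of
    llr exists under each (ae_common_support). *)
Definition logratio (x : Rn k R) : R := ln (f1 x) - ln (f0 x).

Definition common_support (x : Rn k R) : bool := (0 < f0 x) && (0 < f1 x).

Lemma llr_common_support x :
  common_support x -> llr f0 f1 x = (logratio x)%:E.
Proof.
move=> /andP[p0 p1]; rewrite /llr inver gt_eqF// -EFinM lne_EFin ?divr_gt0//.
by rewrite ln_div.
Qed.

Lemma llr_fin_num x : 0 <= f0 x -> 0 <= f1 x ->
  llr f0 f1 x \is a fin_num -> common_support x.
Proof.
rewrite /llr /common_support inver !le_eqVlt.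
move=> /orP[/eqP<-|p0] /orP[/eqP<-|p1]; rewrite ?eqxx.
- by rewrite mul0e/= lexx.
- by rewrite gt0_muley.
- by rewrite mul0e/= lexx.
- by rewrite p0 p1.
Qed.

Hypotheses (pdf0 : is_pdf f0) (pdf1 : is_pdf f1).

Let mf0 : measurable_fun setT f0. Proof. by case: pdf0. Qed.
Let mf1 : measurable_fun setT f1. Proof. by case: pdf1. Qed.
Let f0_ge0 x : 0 <= f0 x. Proof. by case: pdf0. Qed.
Let f1_ge0 x : 0 <= f1 x. Proof. by case: pdf1. Qed.

Lemma measurable_logratio : measurable_fun setT logratio.
Proof. by apply: measurable_funB; apply: measurableT_comp. Qed.

Lemma measurable_common_support : measurable_fun setT common_support.
Proof. by apply: measurable_and; exact: measurable_fun_ltr. Qed.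

(** Where f > 0, integrability makes llr finite, and llr is infinite as soon
    as one of the two densities vanishes. Applied to f0 and f1, this gives the
    mutual absolute continuity of the two laws. *)
Lemma ae_common_support (f : Rn k R -> R) : (forall x, 0 <= f x) ->
  mu.-integrable setT (fun x => llr f0 f1 x * (f x)%:E)%E ->
  {ae mu, forall x, 0 < f x -> common_support x}.
Proof.
move=> fge0 /(integrable_ae measurableT); apply: filterS => x /(_ I) + fx.
move=> H; apply: llr_fin_num => //; move: H; case: (llr f0 f1 x) => [//| |].
- by rewrite gt0_mulye.
- by rewrite gt0_mulNye.
Qed.

Lemma pr_pdf_abs_llr_le (f g : Rn k R -> R) (t : R) :
  (forall x, 0 <= f x) -> measurable_fun setT f ->
  (forall x, 0 <= g x) -> measurable_fun setT g ->
  {ae mu, forall x, 0 < f x -> common_support x} ->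
  {ae mu, forall x, common_support x -> t <= 2 * `|logratio x| -> f x <= g x} ->
  (pr_pdf f [set x | t%:E <= 2%:E * `|llr f0 f1 x|] <= \int[mu]_x (g x)%:E)%E.
Proof.
move=> fge0 mf gge0 mg fpos fg; rewrite /pr_pdf integral_mkcond.
pose h x := if ~~ common_support x || (t <= 2 * `|logratio x|) then f x else 0.
have h0 x : 0 <= h x by rewrite /h; case: ifP.
have mh : measurable_fun setT h.
  apply: measurable_fun_ifT => //; apply: measurable_or.
    by apply: measurable_neg; exact: measurable_common_support.
  apply: measurable_fun_ler => //; apply: measurable_funM => //.
  by apply: measurableT_comp => //; exact: measurable_logratio.
apply: (@le_trans _ _ (\int[mu]_x (h x)%:E)%E).
  apply: ge0_integral_mono => x.
    by apply: erestrict_ge0 => // y _; rewrite lee_fin.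
  rewrite patchE; case: ifPn => [|_]; last by rewrite lee_fin.
  rewrite inE/= /h; have [D|//] := boolP (common_support x).
  by rewrite llr_common_support// lee_fin => ->.
apply: ae_ge0_le_integral => //.
- by move=> x _; rewrite lee_fin.
- exact/measurable_EFinP.
- by move=> x _; rewrite lee_fin.
- exact/measurable_EFinP.
move: fg; apply: filterS2 fpos => x fpos fg _; rewrite lee_fin /h.
case: ifPn => // /orP[nD|tl].
  move: (fge0 x); rewrite le_eqVlt => /orP[/eqP<-//|/fpos D].
  by rewrite D in nD.
have [D|nD] := boolP (common_support x); first exact: fg.
move: (fge0 x); rewrite le_eqVlt => /orP[/eqP<-//|/fpos D].
by rewrite D in nD.
Qed.

(** A set of reals without infimum has inf equal to 0, so positivity of A_of
    ensures that the infimum is a genuine one. *)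
Lemma A_of_le delta t : 0 < A_of f0 f1 delta ->
  (pr_pdf f0 [set x | t%:E <= 2%:E * `|llr f0 f1 x|] <= (delta / 2)%:E)%E ->
  (pr_pdf f1 [set x | t%:E <= 2%:E * `|llr f0 f1 x|] <= (delta / 2)%:E)%E ->
  A_of f0 f1 delta <= t.
Proof.
move=> A0 p0 p1; rewrite /A_of in A0 *; set S := [set t | _] in A0 *.
have [[_ lS]|] := pselect (has_inf S).
  by apply: ge_inf => //; rewrite /S/= ge_max p0 p1.
by move=> /inf_out S0; rewrite S0 ltxx in A0.
Qed.

Variable s2 : R.
Hypothesis int0 : mu.-integrable setT (fun x => llr f0 f1 x * (f0 x)%:E)%E.
Hypothesis sub1 : sub_gaussian f1 (llr f0 f1) s2.

Let int1 : mu.-integrable setT (fun x => llr f0 f1 x * (f1 x)%:E)%E.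
Proof. by case: sub1. Qed.

Let supp0 : {ae mu, forall x, 0 < f0 x -> common_support x}.
Proof. exact: ae_common_support. Qed.

Let supp1 : {ae mu, forall x, 0 < f1 x -> common_support x}.
Proof. exact: ae_common_support. Qed.

Lemma ae_logratio1 : ae_eq mu setT (fun x => llr f0 f1 x * (f1 x)%:E)%E
  (fun x => (logratio x * f1 x)%:E).
Proof.
apply: filterS supp1 => x s1 _; move: (f1_ge0 x).
rewrite le_eqVlt => /orP[/eqP<-|/s1 D]; first by rewrite mule0 mulr0.
by rewrite llr_common_support.
Qed.

Lemma measurable_logratio_f1 :
  measurable_fun setT (fun x => (logratio x * f1 x)%:E).
Proof.
apply/measurable_EFinP; apply: measurable_funM => //.
exact: measurable_logratio.
Qed.

Lemma integrable_logratio : mu.-integrable setT (fun x => (logratio x * f1 x)%:E).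
Proof.
apply/integrableP; split; first exact: measurable_logratio_f1.
have /integrableP[ml] := int1; rewrite (ae_eq_integral
  (fun x => `|(logratio x * f1 x)%:E|)%E) //.
- exact: measurableT_comp.
- by apply: measurableT_comp => //; exact: measurable_logratio_f1.
- by apply: filterS ae_logratio1 => x /[apply] ->.
Qed.

Lemma expect_llr1 : expect_pdf f1 (llr f0 f1) = (I0_of f0 f1)%:E.
Proof. by rewrite /I0_of fineK// integrable_fin_num. Qed.

Lemma integral_logratio : (\int[mu]_x (logratio x * f1 x)%:E = (I0_of f0 f1)%:E)%E.
Proof.
rewrite -expect_llr1; apply/esym; apply: ae_eq_integral => //.
- by case/integrableP: int1.
- exact: measurable_logratio_f1.
- exact: ae_logratio1.
Qed.

Lemma measurable_exp_logratio lambda :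
  measurable_fun setT (fun x => expR (lambda * logratio x) * f1 x).
Proof.
apply: measurable_funM => //; apply: measurableT_comp => //.
by apply: measurable_funM => //; exact: measurable_logratio.
Qed.

Lemma logratio_mgf lambda :
  (\int[mu]_x (expR (lambda * logratio x) * f1 x)%:E <=
   (expR (lambda * I0_of f0 f1 + lambda ^+ 2 * s2 / 2))%:E)%E.
Proof.
set I0 := I0_of f0 f1; case: sub1 => _ /(_ lambda).
rewrite expect_llr1 -/I0 => H.
have scale x : (expR (lambda * logratio x) * f1 x)%:E =
    ((expR (lambda * I0))%:E * (expR (lambda * (logratio x - I0)) * f1 x)%:E)%E.
  by rewrite -EFinM mulrA -expRD; congr (expR _ * _)%:E; ring.
under eq_integral do rewrite scale.
have mg : measurable_fun setT (fun x => expR (lambda * (logratio x - I0)) * f1 x).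
  apply: measurable_funM => //; apply: measurableT_comp => //.
  by apply: measurable_funM => //; apply: measurable_funB => //;
    exact: measurable_logratio.
rewrite ge0_integralZl//; last 2 first.
- exact/measurable_EFinP.
- by move=> x _; rewrite lee_fin mulr_ge0 ?expR_ge0.
rewrite expRD EFinM lee_wpmul2l ?lee_fin ?expR_ge0//.
apply: le_trans H; rewrite /expect_pdf.
pose g x := if common_support x then expR (lambda * (logratio x - I0)) * f1 x else 0.
apply: (@le_trans _ _ (\int[mu]_x (g x)%:E)%E).
  apply: ae_ge0_le_integral => //.
  - by move=> x _; rewrite lee_fin mulr_ge0 ?expR_ge0.
  - exact/measurable_EFinP.
  - by move=> x _; rewrite lee_fin /g; case: ifP => // _; rewrite mulr_ge0 ?expR_ge0.
  - apply/measurable_EFinP; apply: measurable_fun_ifT => //.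
    exact: measurable_common_support.
  apply: filterS supp1 => x s1 _; rewrite lee_fin /g; case: ifPn => // /negP nD.
  by move: (f1_ge0 x); rewrite le_eqVlt => /orP[/eqP<-|/s1//]; rewrite mulr0.
apply: ge0_integral_mono => x; rewrite /g; case: ifPn => [D|_].
- by rewrite lee_fin mulr_ge0 ?expR_ge0.
- by [].
- by rewrite llr_common_support// -EFinB -EFinM/= -EFinM.
- by rewrite mule_ge0 ?expeR_ge0 ?lee_fin.
Qed.

(** exp(- logratio) f1 is f0 on the common support and 0 almost everywhere
    else. *)
Lemma logratio_exp_inv : (\int[mu]_x (expR (- logratio x) * f1 x)%:E <= 1)%E.
Proof.
case: (pdf0) => _ _ <-; apply: ae_ge0_le_integral => //.
- by move=> x _; rewrite lee_fin mulr_ge0 ?expR_ge0.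
- have := measurable_exp_logratio (-1).
  by under eq_fun do rewrite mulN1r; move/measurable_EFinP.
- by move=> x _; rewrite lee_fin.
- exact/measurable_EFinP.
apply: filterS supp1 => x s1 _; rewrite lee_fin.
move: (f1_ge0 x); rewrite le_eqVlt => /orP[/eqP<-|/s1]; first by rewrite mulr0.
move=> /andP[p0 p1]; rewrite /logratio opprB expRD expRN !lnK ?posrE//.
by rewrite divfK// gt_eqF.
Qed.

(** Gibbs' inequality and its equality case: exp(- u) - 1 + u is nonnegative
    and vanishes only at u = 0, while its f1-mean at u = logratio is at most
    I0. Were I0 <= 0, the log-likelihood ratio would vanish almost everywhere
    on the common support, every t > 0 would be admissible in the infimum
    defining A_of, and A_of would be 0. *)
Lemma I0_gt0 delta : 0 < delta -> 0 < A_of f0 f1 delta -> 0 < I0_of f0 f1.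
Proof.
move=> delta0 A0; rewrite ltNge; apply/negP => I0_le0.
pose q x := (expR (- logratio x) - 1 + logratio x) * f1 x.
have mq : measurable_fun setT q.
  apply: measurable_funM => //; apply: measurable_funD => //.
    apply: measurable_funB => //; apply: measurableT_comp => //.
    by apply: measurableT_comp => //; exact: measurable_logratio.
  exact: measurable_logratio.
have q0 x : 0 <= q x.
  by rewrite mulr_ge0//; have := expR_ge1Dx (- logratio x); lra.
have iq : (\int[mu]_x `|(q x)%:E| = 0)%E.
  apply/eqP; rewrite eq_le integral_ge0// andbT.
  under eq_integral do rewrite gee0_abs ?lee_fin//.
  have i1 : mu.-integrable setT (fun x => (f1 x)%:E).
    apply/integrableP; split; first exact/measurable_EFinP.
    under eq_integral do rewrite gee0_abs ?lee_fin//.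
    by case: pdf1 => _ _ ->; exact: ltry.
  have ie : mu.-integrable setT (fun x => (expR (- logratio x) * f1 x)%:E).
    apply/integrableP; split.
      have := measurable_exp_logratio (-1).
      by under eq_fun do rewrite mulN1r; move/measurable_EFinP.
    under eq_integral do rewrite gee0_abs ?lee_fin ?mulr_ge0 ?expR_ge0//.
    by apply: le_lt_trans logratio_exp_inv _; exact: ltry.
  have qE x : (q x)%:E = ((expR (- logratio x) * f1 x)%:E - (f1 x)%:E
      + (logratio x * f1 x)%:E)%E.
    by rewrite -EFinB -EFinD /q; congr EFin; ring.
  under eq_integral do rewrite qE.
  rewrite integralD//; [|exact: integrableB|exact: integrable_logratio].
  rewrite integralB// integral_logratio; case: (pdf1) => _ _ ->.
  have -> : 0%E = (1 - 1 + 0)%:E :> \bar R by rewrite subrr addr0.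
  by rewrite EFinD EFinB leeD// ?lee_fin// leeB// logratio_exp_inv.
have mqE : measurable_fun setT (EFin \o q) by exact/measurable_EFinP.
have ae0 : {ae mu, forall x, common_support x -> logratio x = 0}.
  have /(ae_eq_integral_abs mu measurableT mqE) := iq.
  apply: filterS => x /(_ I) /= [qx0] /andP[_ p1].
  apply: contrapT => /eqP; rewrite -oppr_eq0 => /expR_gt1Dx ltx.
  have : 0 < q x by rewrite mulr_gt0//; lra.
  by rewrite qx0 ltxx.
have small (f : Rn k R -> R) (t : R) : 0 < t ->
    (forall x, 0 <= f x) -> measurable_fun setT f ->
    {ae mu, forall x, 0 < f x -> common_support x} ->
    (pr_pdf f [set x | t%:E <= 2%:E * `|llr f0 f1 x|] <= (delta / 2)%:E)%E.
  move=> t0 fge0 mf sf; apply: (@le_trans _ _ (\int[mu]_x (0 : R)%:E)%E).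
    apply: (@pr_pdf_abs_llr_le f (fun=> 0)) => //.
    apply: filterS ae0 => x /[apply] ->; rewrite normr0 mulr0 => t0'.
    by have := lt_le_trans t0 t0'; rewrite ltxx.
  by rewrite integral0 lee_fin divr_ge0// ltW.
have h2 : 0 < A_of f0 f1 delta / 2 by rewrite divr_gt0.
by have := A_of_le A0 (small f0 _ h2 f0_ge0 mf0 supp0)
  (small f1 _ h2 f1_ge0 mf1 supp1); lra.
Qed.

Lemma integral_two_exp c a b : 0 <= c ->
  (\int[mu]_x (c * (expR (a * logratio x) + expR (b * logratio x)) * f1 x)%:E <=
   (c * (expR (a * I0_of f0 f1 + a ^+ 2 * s2 / 2)
       + expR (b * I0_of f0 f1 + b ^+ 2 * s2 / 2)))%:E)%E.
Proof.
move=> c0; have E x : (c * (expR (a * logratio x) + expR (b * logratio x)) * f1 x)%:E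
  = (c%:E * ((expR (a * logratio x) * f1 x)%:E
           + (expR (b * logratio x) * f1 x)%:E))%E.
  by rewrite -EFinD -EFinM; congr EFin; ring.
under eq_integral do rewrite E.
have e0 l x : (0 <= (expR (l * logratio x) * f1 x)%:E)%E.
  by rewrite lee_fin mulr_ge0 ?expR_ge0.
have me l : measurable_fun setT (fun x => (expR (l * logratio x) * f1 x)%:E).
  by apply/measurable_EFinP; exact: measurable_exp_logratio.
rewrite ge0_integralZl//; last 2 first.
- exact: emeasurable_funD.
- by move=> x _; rewrite adde_ge0.
rewrite ge0_integralD// EFinM EFinD lee_wpmul2l ?lee_fin//.
by rewrite leeD// logratio_mgf.
Qed.

(** The value of t for which the exponential tail bound
    2 exp(I0 + 2 s2) exp(- t / 2) equals delta / 2. *)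
Definition A_bound (delta I0 s2 : R) : R :=
  2 * ln (2 * (2 * expR (I0 + 2 * s2)) / delta).

(** Exponential Markov inequality for both tails of logratio. Under f1 the
    exponents 1 and -1 are used. The density f0 is exp(- logratio) f1, so its
    tails are read under f1, with exponents 0 and -2. *)
Lemma A_of_le_bound delta : 0 < delta -> 0 <= s2 -> 0 < A_of f0 f1 delta ->
  A_of f0 f1 delta <= A_bound delta (I0_of f0 f1) s2.
Proof.
move=> delta0 s20 A0; have I0p := I0_gt0 delta0 A0.
set I0 := I0_of f0 f1 in I0p *; set t := A_bound _ _ _.
pose B := 2 * expR (I0 + 2 * s2).
have B0 : 0 < B by rewrite mulr_gt0 ?expR_gt0.
pose c := expR (- (t / 2)).
have c0 : 0 < c by exact: expR_gt0.
have cB : c * B = delta / 2.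
  rewrite /c /t /A_bound -/B mulrC [2 * ln _]mulrC mulfK// expRN lnK.
    by field; rewrite !gt_eqF.
  by rewrite posrE divr_gt0// mulr_gt0.
have ct (u : R) : t <= 2 * u -> 1 <= c * expR u.
  by move=> tu; rewrite /c -expRD -[leLHS]expR0 ler_expR; lra.
have bound (f : Rn k R -> R) (a b : R) :
    (forall x, 0 <= f x) -> measurable_fun setT f ->
    {ae mu, forall x, 0 < f x -> common_support x} ->
    (forall x, common_support x -> t <= 2 * `|logratio x| ->
      f x <= c * (expR (a * logratio x) + expR (b * logratio x)) * f1 x) ->
    a * I0 + a ^+ 2 * s2 / 2 <= I0 + 2 * s2 ->
    b * I0 + b ^+ 2 * s2 / 2 <= I0 + 2 * s2 ->
    (pr_pdf f [set x | t%:E <= 2%:E * `|llr f0 f1 x|] <= (delta / 2)%:E)%E.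
  move=> fge0 mf sf fle aB bB.
  apply: (@le_trans _ _ (\int[mu]_x
    (c * (expR (a * logratio x) + expR (b * logratio x)) * f1 x)%:E)%E).
    apply: pr_pdf_abs_llr_le => //.
    - by move=> x; rewrite mulr_ge0// mulr_ge0 ?addr_ge0 ?expR_ge0 ?ltW.
    - apply: measurable_funM => //; apply: measurable_funM => //.
      apply: measurable_funD; apply: measurableT_comp => //;
        by apply: measurable_funM => //; exact: measurable_logratio.
    - exact: aeW.
  apply: le_trans (integral_two_exp _ _ (ltW c0)) _.
  rewrite lee_fin -cB ler_wpM2l ?(ltW c0)// /B mulr2n mulrDl mul1r.
  by rewrite lerD// ler_expR.
apply: A_of_le => //.
- apply: (bound f0 0 (-2)) => //; last first.
  + rewrite sqrrN; lra.
  + rewrite mul0r expr0n/=; lra.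
  move=> x D; have /andP[p0 p1] := D.
  have -> : f0 x = expR (- logratio x) * f1 x.
    by rewrite /logratio opprB expRD expRN !lnK ?posrE// divfK// gt_eqF.
  move=> /ct c1; rewrite ler_pM2r// mul0r expR0.
  have [l0|l0] := leP 0 (logratio x).
    rewrite ger0_norm// in c1.
    apply: (@le_trans _ _ c); last by rewrite ler_pMr// lerDl expR_ge0.
    by rewrite -[leLHS]mul1r expRN ler_pdivrMr ?expR_gt0.
  rewrite ltr0_norm// in c1.
  apply: (@le_trans _ _ (c * expR (- 2 * logratio x))); last first.
    by rewrite ler_pM2l// lerDr.
  have -> : - 2 * logratio x = - logratio x + - logratio x by ring.
  by rewrite expRD mulrA ler_peMl ?expR_ge0.
- apply: (bound f1 1 (-1)) => //; last first.
  + rewrite sqrrN expr1n; lra.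
  + rewrite expr1n; lra.
  move=> x _ /ct c1; rewrite ler_peMl// mul1r mulN1r.
  apply: le_trans c1 _; rewrite ler_pM2l//.
  have [l0|l0] := leP 0 (logratio x).
    by rewrite ger0_norm// lerDl expR_ge0.
  by rewrite ltr0_norm// lerDr expR_ge0.
Qed.

End log_likelihood_ratio.

(** * The random walk after the change point *)

Section walk.
Context {R : realType} {k : nat} {d : measure_display} {Omega : measurableType d}.
Variables (X : nat -> {mfun Omega >-> Rn k R})
  (Z : nat -> {mfun Omega >-> R}) (W : {mfun Omega >-> R}).
Variables (P : probability Omega R) (tau : nat) (f0 f1 : Rn k R -> R) (beta : R).
Hypotheses (pdf0 : is_pdf f0) (pdf1 : is_pdf f1).
Hypothesis law : change_point_law X Z W P tau f0 f1 beta.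
Hypothesis beta0 : 0 < beta.

Local Notation L := (logratio f0 f1).
Local Notation src := (sources X Z W).
Local Notation iX t := (inl (inl t) : nat + nat + unit).
Local Notation iZ t := (inl (inr t) : nat + nat + unit).
Local Notation iW := (inr tt : nat + nat + unit).

(** What is known apart from the source i; adapted quantities at a given time
    are measurable for it as long as they ignore i. *)
Definition others (i : nat + nat + unit) : set (set Omega) :=
  \bigcup_(j in [set j | j != i]) src j.

Lemma sources_measurable i : src i `<=` measurable.
Proof. by case: i => [[t|t]|?]; exact: sigma_of_measurable. Qed.

Lemma others_measurable i : <<s others i >> `<=` measurable.
Proof.
apply: smallest_sub; first exact: sigma_algebra_measurable.
by move=> A [j _]; exact: sources_measurable.
Qed.

Lemma others_independent i (A B : set Omega) :
  <<s others i >> A -> src i B -> P (A `&` B) = (P A * P B)%E.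
Proof.
case: law => _ _ _ ind; apply: mutually_independent_others => //.
- exact: sources_measurable.
- by case=> [[t|t]|u]; exact: setI_closed_sigma_of.
- by case=> [[t|t]|u]; exact: sigma_ofT.
Qed.

Lemma others_fubini {d' : measure_display} {T : measurableType d'}
    (i : nat + nat + unit) (Y : {mfun Omega >-> T})
    (h : g_sigma_algebraType (others i) * T -> \bar R) :
  src i = sigma_of Y -> measurable_fun setT h -> (forall z, (0 <= h z)%E) ->
  (\int[P]_w h (w, Y w) = \int[P]_w \int[distribution P Y]_x h (w, x))%E.
Proof.
move=> iY mh h0; apply: independent_fubini => //; first exact: others_measurable.
move=> A B sA mB; apply: (others_independent sA).
by rewrite iY; exists B => //; rewrite setTI.
Qed.

Lemma measurable_others {d' : measure_display} {T : measurableType d'}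
    (i j : nat + nat + unit) (Y : {mfun Omega >-> T}) :
  src j = sigma_of Y -> j != i ->
  measurable_fun setT (Y : g_sigma_algebraType (others i) -> T).
Proof.
move=> jY ji _ B mB; apply: sub_sigma_algebra.
by exists j => //; rewrite jY; exists B.
Qed.

Lemma past_others i A : (forall t, (t < tau)%N -> iX t != i) ->
  past X tau A -> <<s others i >> A.
Proof.
move=> Hi; apply: sub_sigma_algebra2 => B [[//|t] /= tt' XB].
by exists (iX t) => //=; exact: Hi.
Qed.

Lemma past_measurable : past X tau `<=` measurable.
Proof.
apply: smallest_sub; first exact: sigma_algebra_measurable.
by move=> A [j _]; exact: sigma_of_measurable.
Qed.

(** The CUSUM statistic restarted at the change point, without reflection. *)
Definition walk (n : nat) (w : Omega) : R :=
  \sum_(i < n) L (X (tau + i).+1 w).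

Lemma measurable_walk i n : (forall t, (t < n)%N -> iX (tau + t) != i) ->
  measurable_fun setT (walk n : g_sigma_algebraType (others i) -> R).
Proof.
move=> Hi; apply: measurable_sum => t.
apply: measurableT_comp; first exact: measurable_logratio.
by apply: (@measurable_others _ _ _ (iX (tau + t))) => //; exact: Hi.
Qed.

Variable b : R.

(** How far the walk is below the noisy threshold when the observation noise
    takes the value z. *)
Definition gap (n : nat) (z : R) (w : Omega) : R := b + W w - z - walk n w.

Variable A : set Omega.
Hypothesis pastA : past X tau A.

Let mA : measurable A. Proof. exact: past_measurable. Qed.

Lemma measurable_indic_others i : (forall t, (t < tau)%N -> iX t != i) ->
  measurable_fun setT (\1_A : g_sigma_algebraType (others i) -> R).
Proof.
by move=> Hi; apply: measurable_indic; exact: past_others pastA.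
Qed.

Lemma measurable_gap (i : nat + nat + unit) n :
  (forall t, (t < n)%N -> iX (tau + t) != i) -> iW != i ->
  measurable_fun setT
    (fun p : g_sigma_algebraType (others i) * R => gap n p.2 p.1).
Proof.
move=> Hi Wi; apply: measurable_funB; last first.
  by apply: measurableT_comp; [exact: measurable_walk|exact: measurable_fst].
apply: measurable_funB => //; apply: measurable_funD => //.
apply: measurableT_comp; last exact: measurable_fst.
exact: (@measurable_others _ _ _ iW).
Qed.

Lemma measurable_gapT n t : measurable_fun setT (fun w => gap n (Z t w) w).
Proof.
apply: measurable_funB; last first.
  apply: measurable_sum => i; apply: measurableT_comp => //.
  exact: measurable_logratio.
by apply: measurable_funB => //; apply: measurable_funD.
Qed.

(** The walk has not crossed the threshold at its n-th step, judged with the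
    noise Z t, on the event A of the past. *)
Definition alive (n t : nat) (w : Omega) : \bar R :=
  (\1_A w * (0 < gap n (Z t w) w)%R%:R)%:E.

Lemma alive_ge0 n t w : (0 <= alive n t w)%E.
Proof. by rewrite lee_fin mulr_ge0. Qed.

Lemma measurable_alive n t : measurable_fun setT (alive n t).
Proof.
apply/measurable_EFinP; apply: measurable_funM => //.
apply: measurable_bool_real; apply: measurable_fun_ltr => //.
exact: measurable_gapT.
Qed.

Lemma distribution_noise t B : measurable B ->
  distribution P (Z t.+1) B = distribution P (Z 1) B.
Proof.
move=> mB; case: law => _ lZ _ _.
by rewrite /= /distribution /pushforward !lZ.
Qed.

(** At a single time, the noise Z t is independent of the walk, of W and of A,
    so that only its law matters. Replacing it by Z 1 for all n makes
    consecutive gaps differ by one increment of the walk only. *)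
Lemma alive_swap n t : (\int[P]_w alive n t.+1 w = \int[P]_w alive n 1 w)%E.
Proof.
have swap s : (\int[P]_w alive n s.+1 w = \int[P]_w \int[distribution P (Z 1)]_z
    (\1_A w * (0 < gap n z w)%R%:R)%:E)%E.
  pose h (p : g_sigma_algebraType (others (iZ s)) * R) : \bar R :=
    (\1_A p.1 * (0 < gap n p.2 p.1)%R%:R)%:E.
  have := @others_fubini _ _ (iZ s) (Z s.+1) h erefl.
  rewrite /h/= => ->.
  - apply: eq_integral => w _; apply: eq_measure_integral => B mB _.
    exact: distribution_noise.
  - apply/measurable_EFinP; apply: measurable_funM.
      by apply: measurableT_comp;
      [exact: measurable_indic_others|exact: measurable_fst].
    by apply: measurable_bool_real; apply: measurable_fun_ltr => //;
      exact: measurable_gap.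
  - by move=> z; rewrite lee_fin mulr_ge0.
by rewrite !swap.
Qed.

Section drift_along_walk.
Variables (th I M rho K : R).
Hypotheses (intL : (lebesgue_tuple k).-integrable setT (fun x => (L x * f1 x)%:E)).
Hypothesis EL : (\int[lebesgue_tuple k]_x (L x * f1 x)%:E = I%:E)%E.
Hypothesis EexpL :
  (\int[lebesgue_tuple k]_x (expR (th * L x) * f1 x)%:E <= M%:E)%E.
Hypothesis EexpNL :
  (\int[lebesgue_tuple k]_x (expR (- (th * L x)) * f1 x)%:E <= rho%:E)%E.
Hypotheses (th0 : 0 < th) (I0 : 0 < I) (K0 : 0 <= K).
Hypothesis KM : (M + rho) / (th * I) <= K * (1 - rho).

Let ph0 y : 0 <= gap_potential th I K y. Proof. by rewrite gap_potential_ge0// ltW. Qed.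

(** After the change point, the increments have density f1. *)
Lemma post_change_drift n y :
  (\int[distribution P (X (tau + n).+1)]_x (gap_potential th I K (y - L x))%:E
    + ((0 < y)%R%:R)%:E <= (gap_potential th I K y)%:E)%E.
Proof.
have [_ pf1 _] := pdf1; have [mf1 _ _] := pdf1.
have Xf1 : has_density P (lebesgue_tuple k) (X (tau + n).+1) f1.
  by case: law => /(_ (tau + n).+1 isT) + _ _ _; rewrite leqNgt ltnS leq_addr.
have mL := measurable_logratio pdf0 pdf1.
have [iL eL] := integral_density Xf1 mf1 pf1 mL intL.
have mthL : measurable_fun setT (fun x => th * L x) by exact: measurable_funM.
have expE (g : Rn k R -> R) : measurable_fun setT g -> (forall x, 0 <= g x) ->
    (\int[distribution P (X (tau + n).+1)]_x (g x)%:E =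
     \int[lebesgue_tuple k]_x (g x * f1 x)%:E)%E.
  move=> mg g0.
  rewrite (ge0_integral_distribution (X (tau + n).+1 : {RV P >-> _}))//=;
    last exact/measurable_EFinP.
  by rewrite (ge0_integral_density Xf1 (g := EFin \o g))//; exact/measurable_EFinP.
apply: (@gap_potential_drift _ _ _ (distribution P (X (tau + n).+1)) L
  th I M rho K) => //.
- by rewrite eL.
- rewrite expE//; exact: measurableT_comp.
- rewrite expE//.
  by apply: measurableT_comp => //; exact: measurableT_comp.
Qed.

Definition energy (n : nat) (w : Omega) : \bar R :=
  (\1_A w * gap_potential th I K (gap n (Z 1 w) w))%:E.

Lemma energy_ge0 n w : (0 <= energy n w)%E.
Proof. by rewrite lee_fin mulr_ge0. Qed.

Lemma measurable_energy n : measurable_fun setT (energy n).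
Proof.
apply/measurable_EFinP; apply: measurable_funM => //.
by apply: measurableT_comp; [exact: measurable_gap_potential|exact: measurable_gapT].
Qed.

(** The increment number n is independent of A, W, Z 1 and of the walk up to
    n: freeze these and apply post_change_drift. *)
Lemma energy_step n :
  (\int[P]_w energy n.+1 w + \int[P]_w alive n 1 w <= \int[P]_w energy n w)%E.
Proof.
rewrite -ge0_integralD//; last 4 first.
- by move=> w _; exact: energy_ge0.
- exact: measurable_energy.
- by move=> w _; exact: alive_ge0.
- exact: measurable_alive.
set i := iX (tau + n).
have iN t : (t < n)%N -> iX (tau + t) != i.
  by move=> tn; apply/eqP => -[] /addnI tE; rewrite tE ltnn in tn.
have iT t : (t < tau)%N -> iX t != i.
  by move=> tn; apply/eqP => -[] tE; rewrite tE ltnNge leq_addr in tn.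
pose v (w : g_sigma_algebraType (others i)) := gap n (Z 1 w) w.
have mv : measurable_fun setT v.
  pose p (w : g_sigma_algebraType (others i)) := (w, Z 1 w).
  have mp : measurable_fun setT p.
    apply: measurable_fun_pair => //.
    exact: (@measurable_others _ _ _ (iZ 0)).
  by apply: (measurableT_comp (measurable_gap iN _) mp).
pose h (p : g_sigma_algebraType (others i) * Rn k R) : \bar R := (\1_A p.1 *
  (gap_potential th I K (v p.1 - L p.2) + (0 < v p.1)%R%:R))%:E.
rewrite (eq_integral (fun w => h (w, X (tau + n).+1 w))); last first.
  move=> w _; rewrite /energy /alive /h /= -EFinD -mulrDr.
  by rewrite /v /gap /walk big_ord_recr/= opprD !addrA.
rewrite (others_fubini (i := i))//; last 2 first.
- apply/measurable_EFinP; apply: measurable_funM.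
    by apply: measurableT_comp;
      [exact: measurable_indic_others|exact: measurable_fst].
  apply: measurable_funD.
    apply: measurableT_comp; first exact: measurable_gap_potential.
    apply: measurable_funB.
      by apply: measurableT_comp; [exact: mv|exact: measurable_fst].
    by apply: measurableT_comp; [exact: measurable_logratio|exact: measurable_snd].
  apply: measurable_bool_real; apply: measurable_fun_ltr => //.
  by apply: measurableT_comp; [exact: mv|exact: measurable_fst].
- by move=> z; rewrite lee_fin mulr_ge0// addr_ge0.
apply: ge0_integral_mono => w.
  by apply: integral_ge0 => x _; rewrite lee_fin mulr_ge0// addr_ge0.
rewrite /h/= /energy -/(v w).
have mpot : measurable_fun setT (fun x => gap_potential th I K (v w - L x)).
  apply: measurableT_comp; first exact: measurable_gap_potential.
  by apply: measurable_funB => //; exact: measurable_logratio.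
under eq_integral do rewrite EFinM EFinD.
rewrite ge0_integralZl//; last 2 first.
- by apply: emeasurable_funD => //; exact/measurable_EFinP.
- by move=> x _; rewrite -EFinD lee_fin addr_ge0.
rewrite EFinM lee_wpmul2l ?lee_fin//.
rewrite ge0_integralD//; [|by move=> x _; rewrite lee_fin|exact/measurable_EFinP].
rewrite integral_cst//.
rewrite [X in (_ + _ * X)%E](_ : _ = 1%E); last exact: probability_setT.
rewrite mule1; exact: post_change_drift.
Qed.

Lemma sum_alive_le N :
  (\sum_(n < N) \int[P]_w alive n 1 w + \int[P]_w energy N w
    <= \int[P]_w energy 0 w)%E.
Proof.
elim: N => [|N IH]; first by rewrite big_ord0 add0e.
apply: le_trans IH; rewrite big_ord_recr/= -addeA leeD2l// addeC.
exact: energy_step.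
Qed.

(** The noise is independent of A. *)
Lemma noise_moment (i : nat + nat + unit) (Y : {mfun Omega >-> R}) :
  src i = sigma_of Y -> (forall t, (t < tau)%N -> iX t != i) ->
  has_density P lebesgue_measure Y (laplace_pdf beta) ->
  (\int[P]_w (\1_A w * `|Y w|)%:E <= (4 * beta)%:E * P A)%E.
Proof.
move=> iY Hi dY.
pose h (p : g_sigma_algebraType (others i) * R) : \bar R := (\1_A p.1 * `|p.2|)%:E.
rewrite (others_fubini (h := h) iY); last 2 first.
- apply/measurable_EFinP; apply: measurable_funM.
    by apply: measurableT_comp;
      [exact: measurable_indic_others|exact: measurable_fst].
  by apply: measurableT_comp => //; exact: measurable_snd.
- by move=> z; rewrite lee_fin mulr_ge0.
pose nrm (x : R) : \bar R := `|x|%:E.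
have mnorm : measurable_fun setT nrm by exact/measurable_EFinP.
have nrm0 x : (0 <= nrm x)%E by rewrite lee_fin.
have EY : (\int[distribution P Y]_x nrm x <= (4 * beta)%:E)%E.
  rewrite (ge0_integral_distribution (Y : {RV P >-> _}))//=.
  have mY : @measurable_fun _ _ Omega (measurableTypeR R) setT Y.
    by move=> mT B mB; exact: (measurable_funPT Y).
  pose Y' : {mfun Omega >-> measurableTypeR R} :=
    HB.pack (Y : Omega -> measurableTypeR R) (isMeasurableFun.Build _ _ _ _ _ mY).
  rewrite (@ge0_integral_density _ _ _ _ _ P lebesgue_measure Y' _ nrm dY)//.
  - exact: laplace_abs_moment.
  - exact: measurable_laplace_pdf.
  - by move=> x; exact: laplace_pdf_ge0.
apply: (@le_trans _ _ (\int[P]_w ((4 * beta)%:E * (\1_A w)%:E))%E).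
  apply: ge0_integral_mono => w.
    by apply: integral_ge0 => x _; rewrite lee_fin mulr_ge0.
  rewrite /h/= (eq_integral (fun x => ((\1_A w)%:E * nrm x)%E))//.
  by rewrite ge0_integralZl// ?lee_fin// muleC lee_wpmul2r// ?lee_fin.
rewrite ge0_integralZl//.
- by rewrite integral_indic// setIT.
- exact/measurable_EFinP.
- by rewrite lee_fin mulr_ge0// ltW.
Qed.

Hypothesis b0 : 0 < b.

Lemma initial_energy :
  (\int[P]_w energy 0 w <= (b / I + 8 * beta / I + 2 * K)%:E * P A)%E.
Proof.
have [_ lZ lW _] := law.
have EW := @noise_moment iW W erefl (fun t _ => isT) lW.
have EZ := @noise_moment (iZ 0) (Z 1) erefl (fun t _ => isT) (lZ 1%N isT).
pose c := b / I + 2 * K.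
have c0 : 0 <= c by apply: addr_ge0; [apply: divr_ge0; exact: ltW|rewrite mulr_ge0].
have mc : measurable_fun setT (fun w => (c%:E * (\1_A w)%:E)%E).
  by apply: emeasurable_funM => //; exact/measurable_EFinP.
have mN (Y : {mfun Omega >-> R}) : measurable_fun setT (fun w => (\1_A w * `|Y w|)%:E).
  apply/measurable_EFinP; apply: measurable_funM => //.
  exact: measurableT_comp.
have mIN (Y : {mfun Omega >-> R}) :
    measurable_fun setT (fun w => (I^-1%:E * (\1_A w * `|Y w|)%:E)%E).
  by apply: emeasurable_funM.
have N0 (Y : {mfun Omega >-> R}) w : (0 <= (\1_A w * `|Y w|)%:E)%E.
  by rewrite lee_fin mulr_ge0.
have IN0 (Y : {mfun Omega >-> R}) w : (0 <= I^-1%:E * (\1_A w * `|Y w|)%:E)%E.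
  by rewrite mule_ge0// lee_fin invr_ge0 ltW.
have C0 w : (0 <= c%:E * (\1_A w)%:E)%E by rewrite mule_ge0 ?lee_fin.
apply: (@le_trans _ _ (\int[P]_w (c%:E * (\1_A w)%:E +
   (I^-1%:E * (\1_A w * `|W w|)%:E + I^-1%:E * (\1_A w * `|Z 1 w|)%:E)))%E).
  apply: ge0_integral_mono => w; first exact: energy_ge0.
  rewrite /energy -!EFinM -!EFinD lee_fin.
  have -> : c * \1_A w + (I^-1 * (\1_A w * `|W w|) + I^-1 * (\1_A w * `|Z 1 w|)) =
    \1_A w * ((b + `|W w| + `|Z 1 w|) / I + 2 * K) by rewrite /c; ring.
  apply: ler_wpM2l => //; apply: gap_potential_le => //; first exact: ltW.
    by rewrite !addr_ge0 // ltW.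
  rewrite /gap /walk big_ord0 subr0 lerD//.
    by rewrite lerD2l ler_norm.
  by rewrite -normrN ler_norm.
rewrite ge0_integralD//; last 2 first.
- by move=> w _; rewrite adde_ge0.
- exact: emeasurable_funD.
rewrite ge0_integralD// !ge0_integralZl ?lee_fin ?invr_ge0 ?(ltW I0)//; last first.
  exact/measurable_EFinP.
rewrite integral_indic// setIT.
apply: (@le_trans _ _ (c%:E * P A + (I^-1%:E * ((4 * beta)%:E * P A)
   + I^-1%:E * ((4 * beta)%:E * P A)))%E).
  by rewrite leeD2l// leeD// lee_wpmul2l// lee_fin invr_ge0 ltW.
have PAf : P A \is a fin_num by exact: fin_num_measure.
rewrite -[P A]fineK// -!EFinM -!EFinD lee_fin /c le_eqVlt; apply/orP; left.
by apply/eqP; ring.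
Qed.

Lemma sum_alive_bound N :
  (\sum_(0 <= n < N) \int[P]_w alive n.+1 1 w <=
    (b / I + 8 * beta / I + 2 * K)%:E * P A)%E.
Proof.
apply: le_trans initial_energy; apply: le_trans (sum_alive_le N.+1).
rewrite big_mkord big_ord_recl/= -addeA addeCA leeDl// adde_ge0//.
  by apply: integral_ge0 => w _; exact: alive_ge0.
by apply: integral_ge0 => w _; exact: energy_ge0.
Qed.

Hypothesis supp1 : {ae lebesgue_tuple k, forall x, 0 < f1 x -> common_support f0 f1 x}.

Lemma ae_post_change_support :
  {ae P, forall w, forall t, common_support f0 f1 (X (tau + t).+1 w)}.
Proof.
have [mf1 _ _] := pdf1.
apply/ae_foralln => t.
have Xf1 : has_density P (lebesgue_tuple k) (X (tau + t).+1) f1.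
  by case: law => /(_ (tau + t).+1 isT) + _ _ _; rewrite leqNgt ltnS leq_addr.
pose B : set (Rn k R) := [set x | ~~ common_support f0 f1 x].
have mB : measurable B.
  have := measurable_neg (measurable_common_support pdf0 pdf1).
  move=> /(_ measurableT [set true]); rewrite setTI; apply => //.
exists (X (tau + t).+1 @^-1` B); split => //.
- exact: measurable_funPTI.
- transitivity (\int[lebesgue_tuple k]_(x in B) (f1 x)%:E)%E; first exact: Xf1.
  rewrite (ae_eq_integral (cst 0%E)) ?integral0//.
    by apply: measurable_funTS; exact/measurable_EFinP.
  apply: filterS supp1 => x s1 /negP nD /=; congr EFin; apply/eqP.
  have [_ /(_ x) + _] := pdf1; rewrite le_eqVlt => /orP[/eqP<-//|/s1 D].
  by rewrite D in nD.
- by move=> w /= /negP.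
Qed.

(** Reflection at 0 can only raise the statistic. The first inequality is the
    induction invariant; it also covers n = 0, where the statistic inherited
    from the pre-change period may be negative. *)
Lemma cusum_ge_walk n w :
  (forall t, (t < n)%N -> common_support f0 f1 (X (tau + t).+1 w)) ->
  ((walk n w)%:E <= maxe 0 (cusum f0 f1 (X ^~ w) (tau + n)))%E /\
  ((0 < n)%N -> ((walk n w)%:E <= cusum f0 f1 (X ^~ w) (tau + n))%E).
Proof.
elim: n => [_|n IH sn]; first by split => //; rewrite /walk big_ord0 le_max lexx.
have [|wn _] := IH; first by move=> t tn; apply: sn; exact: ltnW.
suff H : ((walk n.+1 w)%:E <= cusum f0 f1 (X ^~ w) (tau + n.+1))%E.
  by split => // ; rewrite le_max H orbT.
rewrite addnS/= llr_common_support; last exact: sn.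
by rewrite /walk big_ord_recr/= EFinD leeD2r.
Qed.

(** Passing this test at n is necessary for the procedure not to have stopped
    by time tau + n + 1; the second alternative takes care of the null event
    where some likelihood ratio is degenerate. *)
Definition waiting (n : nat) (w : Omega) : bool :=
  (0 < gap n.+1 (Z (tau + n).+1 w) w)
  || ~~ all (fun t => common_support f0 f1 (X (tau + t).+1 w)) (iota 0 n.+1).

Lemma measurable_waiting n : measurable_fun setT (waiting n).
Proof.
apply: measurable_or.
  by apply: measurable_fun_ltr => //; exact: measurable_gapT.
apply: measurable_neg; elim: (iota _ _) => [|t s IH] /=; first exact: measurable_cst.
apply: measurable_and => //; apply: measurableT_comp => //.
exact: measurable_common_support.
Qed.

Lemma dp_stop_le n w : ~~ waiting n w ->
  (dp_stop X Z W f0 f1 b w <= (tau + n.+1)%:R%:E)%E.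
Proof.
rewrite negb_or -leNgt negbK => /andP[gap0 /allP supp].
apply: ereal_inf_lbound; exists (tau + n.+1)%N => //; split; first by rewrite addnS.
have [|_ /(_ isT) wc] := @cusum_ge_walk n.+1 w.
  by move=> t tn; apply: supp; rewrite mem_iota.
apply: (@le_trans _ _ ((walk n.+1 w)%:E + (Z (tau + n.+1) w)%:E)%E).
  by rewrite -EFinD lee_fin addnS; move: gap0; rewrite /gap; lra.
by rewrite leeD2r.
Qed.

(** If m is the first index that fails the test, then the delay is at most
    m + 1 and the m indices before it all contribute to the sum; if no index
    fails it, the sum diverges. *)
Lemma delay_le w :
  (maxe (dp_stop X Z W f0 f1 b w - tau%:R%:E) 0
   <= 1 + \sum_(0 <= n <oo) ((waiting n w)%:R)%:E)%E.
Proof.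
pose u n : \bar R := ((waiting n w)%:R)%:E.
have u0 n : (0 <= u n)%E by rewrite lee_fin.
have partial N : (forall n, (n < N)%N -> waiting n w) ->
    (N%:R%:E <= \sum_(0 <= n <oo) u n)%E.
  move=> wN; apply: le_trans (nneseries_lim_ge N _) => //.
  rewrite big_mkord (eq_bigr (fun=> 1%E)); last by move=> n _; rewrite /u wN.
  by rewrite sumEFin sumr_const card_ord.
have [[n0 wn0]|allw] := pselect (exists n, ~~ waiting n w); last first.
  suff -> : (\sum_(0 <= n <oo) u n = +oo)%E by rewrite addey ?leey.
  apply: eq_infty => r; apply: le_trans (partial (Num.truncn r).+1 _).
    by rewrite lee_fin ltW// truncnS_gt.
  by move=> n _; apply: contrapT => /negP nw; apply: allw; exists n.
case: (ex_minnP (ex_intro (fun n => ~~ waiting n w) n0 wn0)) => m wm mmin.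
apply: (@le_trans _ _ (1 + m%:R%:E)%E); last first.
  rewrite leeD2l//; apply: partial => n nm; apply: contraT => /mmin.
  by rewrite leqNgt nm.
rewrite ge_max; apply/andP; split; last by rewrite -EFinD lee_fin addr_ge0.
rewrite leeBlDr//; apply: le_trans (dp_stop_le wm) _.
by rewrite -!EFinD lee_fin natrD -[in X in _ + X]natr1; lra.
Qed.

(** Sum the delays over n, replace each noise by Z 1, and telescope the
    energies. *)
Lemma delay_integral_le :
  (\int[P]_(w in A) maxe (dp_stop X Z W f0 f1 b w - tau%:R%:E) 0
   <= (1 + b / I + 8 * beta / I + 2 * K)%:E * P A)%E.
Proof.
pose wt n w : \bar R := (\1_A w * (waiting n w)%:R)%:E.
have wt0 n w : (0 <= wt n w)%E by rewrite lee_fin mulr_ge0.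
have mwt n : measurable_fun setT (wt n).
  apply/measurable_EFinP; apply: measurable_funM => //.
  by apply: measurable_bool_real; exact: measurable_waiting.
have mind : measurable_fun setT (fun w => (\1_A w)%:E : \bar R).
  exact/measurable_EFinP.
rewrite integral_mkcond.
apply: (@le_trans _ _ (\int[P]_w ((\1_A w)%:E + \sum_(0 <= n <oo) wt n w))%E).
  apply: ge0_integral_mono => w.
    by apply: erestrict_ge0 => // v _; rewrite le_max lexx orbT.
  rewrite patchE /wt indicE; case: ifPn => [_|_].
    rewrite (eq_eseriesr (g := fun n => ((waiting n w)%:R)%:E)).
      exact: delay_le.
    by move=> n _; rewrite mul1r.
  by rewrite add0e; apply: nneseries_ge0 => n _; rewrite mul0r.
rewrite ge0_integralD//; last 2 first.
- by move=> w _; exact: nneseries_ge0.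
- exact: ge0_emeasurable_sum.
rewrite integral_nneseries// integral_indic// setIT.
have -> : ((1 + b / I + 8 * beta / I + 2 * K)%:E * P A =
    P A + (b / I + 8 * beta / I + 2 * K)%:E * P A)%E.
  rewrite -[P A]fineK ?fin_num_measure// -!EFinM -EFinD; congr EFin; ring.
rewrite leeD2l//; apply: lime_le.
  by apply: is_cvg_nneseries => n _ _; exact: integral_ge0.
apply: nearW => N; apply: le_trans (sum_alive_bound N).
apply: lee_sum => n _; rewrite -(alive_swap n.+1 (tau + n)).
apply: ae_ge0_le_integral => //.
- by move=> w _; exact: alive_ge0.
- exact: measurable_alive.
apply: filterS ae_post_change_support => w sw _.
rewrite /wt /alive /waiting (_ : all _ _) ?orbF//.
exact/allP.
Qed.

End drift_along_walk.
End walk.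

(** * The bound on the detection delay *)

(** Here th makes exp(- th logratio) have mean at most rho < 1 under f1, M
    bounds the mean of exp(th logratio), and K is the smallest constant that
    gap_potential_drift allows. The denominator s2 + 1 keeps th positive for
    every s2 >= 0. The term in A_bound accounts for the mean absolute values of
    the two noises, 4 times their scale each. *)
Definition delay_constant {R : realType} (eps delta I0 s2 : R) : R :=
  let th := I0 / (s2 + 1) in
  let rho := expR (- (th * I0 / 2)) in
  let M := expR (th * I0 + th ^+ 2 * s2 / 2) in
  let K := (M + rho) / (th * I0) / (1 - rho) in
  1 + 8 * (2 * A_bound delta I0 s2 / eps) / I0 + 2 * K.

Theorem corollary2 (R : realType) :
  exists C : R -> R -> R -> R -> R,
  forall (k : nat) (f0 f1 : Rn k R -> R) (sigma eps delta : R),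
  is_pdf f0 -> is_pdf f1 -> f0 <> f1 ->
  sub_gaussian f0 (llr f0 f1) (sigma ^+ 2) ->
  sub_gaussian f1 (llr f0 f1) (sigma ^+ 2) ->
  0 < eps -> 0 < delta < 1 -> 0 < A_of f0 f1 delta ->
  let A := A_of f0 f1 delta in
  let I0 := I0_of f0 f1 in
  forall (d : measure_display) (Omega : measurableType d)
    (X : nat -> {mfun Omega >-> Rn k R})
    (Z : nat -> {mfun Omega >-> R}) (W : {mfun Omega >-> R})
    (P : nat -> probability Omega R),
  (forall tau : nat, change_point_law X Z W (P tau) tau f0 f1 (2 * A / eps)) ->
  forall b : R, 0 < b ->
  (WADD X P (dp_stop X Z W f0 f1 b) <=
   (b / I0 + 4 * A / (I0 `^ (3 / 2) * eps) * Num.sqrt b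
    + C eps delta I0 (sigma ^+ 2))%:E)%E.
Proof.
exists delay_constant => k f0 f1 sigma eps delta pdf0 pdf1 _ [int0 _] sub1 eps0.
move=> /andP[delta0 _] A0 A I0 d Omega X Z W P law b b0.
pose s2 := sigma ^+ 2; rewrite -/s2.
have s20 : 0 <= s2 by exact: sqr_ge0.
have I0p : 0 < I0 by exact: I0_gt0 sub1 _ delta0 A0.
have AB : A <= A_bound delta I0 s2 by exact: A_of_le_bound.
have beta0 : 0 < 2 * A / eps by rewrite divr_gt0 ?mulr_gt0.
pose th := I0 / (s2 + 1).
have th0 : 0 < th by rewrite divr_gt0// ltr_wpDl.
have ths2 : th * s2 <= I0.
  rewrite /th mulrAC ler_pdivrMr ?ltr_wpDl// ler_pM2l//; lra.
pose rho := expR (- (th * I0 / 2)).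
have thI : 0 < th * I0 by rewrite mulr_gt0.
have rho1 : rho < 1 by rewrite /rho -[ltRHS]expR0 ltr_expR oppr_lt0 divr_gt0.
pose M := expR (th * I0 + th ^+ 2 * s2 / 2).
pose K := (M + rho) / (th * I0) / (1 - rho).
have K0 : 0 <= K.
  by rewrite divr_ge0 ?subr_ge0 ?(ltW rho1)// divr_ge0 ?(ltW thI)// addr_ge0 ?expR_ge0.
have KM : (M + rho) / (th * I0) <= K * (1 - rho).
  by rewrite /K divfK// subr_eq0 gt_eqF.
have EM := logratio_mgf pdf0 pdf1 sub1 th.
have Erho : (\int[lebesgue_tuple k]_x
    (expR (- (th * logratio f0 f1 x)) * f1 x)%:E <= rho%:E)%E.
  have := logratio_mgf pdf0 pdf1 sub1 (- th).
  under eq_integral do rewrite mulNr.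
  move=> /le_trans; apply; rewrite lee_fin ler_expR sqrrN mulNr -/I0 -/s2.
  have : th * (th * s2) <= th * I0 by rewrite ler_pM2l.
  rewrite expr2; lra.
have supp1 : {ae lebesgue_tuple k, forall x, 0 < f1 x -> common_support f0 f1 x}.
  by apply: ae_common_support => //; [case: pdf1|case: sub1].
apply: (@le_trans _ _ (1 + b / I0 + 8 * (2 * A / eps) / I0 + 2 * K)%:E).
  apply: ge_ereal_sup => _ [tau [Y [EY ->]]].
  apply: (condexp_ess_sup_le _ (@past_measurable _ _ _ _ X tau) EY) => [|B pB].
    have bI : 0 <= b / I0 by apply: divr_ge0; exact: ltW.
    have AI : 0 <= 8 * (2 * A / eps) / I0
      by apply: divr_ge0; [apply: mulr_ge0 => //; exact: ltW|exact: ltW].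
    lra.
  exact: (delay_integral_le pdf0 pdf1 (law tau) beta0 pB
    (integrable_logratio pdf0 pdf1 sub1) (integral_logratio pdf0 pdf1 sub1) EM Erho).
rewrite lee_fin /delay_constant -/th -/rho -/M -/K.
have S0 : 0 <= 4 * A / (I0 `^ (3 / 2) * eps) * Num.sqrt b.
  rewrite mulr_ge0 ?sqrtr_ge0// divr_ge0 ?mulr_ge0 ?powR_ge0// ltW//.
have : 8 * (2 * A / eps) / I0 <= 8 * (2 * A_bound delta I0 s2 / eps) / I0.
  by rewrite ler_pM2r ?invr_gt0// ler_pM2l// ler_pM2r ?invr_gt0// ler_pM2l.
lra.
Qed.
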